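(* Let $g:[0,\infty)\to\mathbb{R}$ be a function of class $C^3([0,\infty))$ with $g^{(3)}(0)=0$ such that the following conditions hold: (i) $g'(0)=0$ and $g''(t)>0$ for all $t\geq 0$; (ii) there are constants $m,M>0$ such that $m(t-1)\leq g(t)\leq M(t+1)$ for all $t\in[0,\infty)$; (iii) there are an exponent $\mu>1$ and a constant $c>0$ such that $g''(t)\leq c(1+t)^{-\mu}$ for all $t\geq 0$; (iv) $\int_0^\infty s\,g''(s)\,ds<\infty$. If $u\in C^3(\mathbb{R}^2)$ is a real-valued entire solution of $$\operatorname{div}\left(\frac{g'(|\nabla u|)}{|\nabla u|}\nabla u\right)=0\quad\text{on }\mathbb{R}^2,$$ then $u$ is an affine function.
   Context: Derivatives of $g$ at $t=0$ are one-sided. The vector field $a(p):=\frac{g'(|p|)}{|p|}p$, $p\in\mathbb{R}^2$, is understood to take the value $a(0)=0$ at $p=0$ (using $g'(0)=0$); equivalently $a=\nabla f$ with $f(p):=g(|p|)$. It is of class $C^1(\mathbb{R}^2,\mathbb{R}^2)$, so the equation $\operatorname{div}(a(\nabla u))=0$ is meant in the classical pointwise sense. ''Entire'' means defined on all of $\mathbb{R}^2$. *)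

(* Defs.v *)
From Stdlib Require Import Reals Lra.
From Coquelicot Require Import Coquelicot.
Open Scope R_scope.

(* Derivative relative to a set D: two-sided at interior points of D, one-sided
   at an endpoint of an interval. It uses no value of f outside D. *)
Definition is_derive_within (D : R -> Prop) (f : R -> R) (x l : R) : Prop :=
  filterdiff f (within D (locally x)) (fun y : R => scal y l).

Definition ex_derive_within (D : R -> Prop) (f : R -> R) (x : R) : Prop :=
  exists l : R, is_derive_within D f x l.

(* Like Derive, this is meaningful only where the derivative exists. *)
Definition Derive_within (D : R -> Prop) (f : R -> R) (x : R) : R :=
  iota (fun l : R => is_derive_within D f x l).

Fixpoint Derive_n_within (D : R -> Prop) (f : R -> R) (n : nat) : R -> R :=
  match n with
  | 0%nat => f
  | S k => Derive_within D (Derive_n_within D f k)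
  end.

Definition class_C_within (D : R -> Prop) (n : nat) (f : R -> R) : Prop :=
  (forall k : nat, (k < n)%nat ->
     forall x : R, D x -> ex_derive_within D (Derive_n_within D f k) x) /\
  (forall k : nat, (k <= n)%nat -> continuous_on D (Derive_n_within D f k)).

Definition nonneg_half_line (t : R) : Prop := 0 <= t.

Notation "g ^[ n ]" := (Derive_n_within nonneg_half_line g n)
  (at level 1, format "g ^[ n ]").

Lemma is_derive_within_half_line_unique (f : R -> R) (x l : R) :
  0 <= x -> is_derive_within nonneg_half_line f x l ->
  Derive_within nonneg_half_line f x = l.
Proof.
intros Hx Hl.
assert (Hlim : is_filter_lim (within nonneg_half_line (locally x)) x).
{ intros P HP; unfold within; revert HP; apply filter_imp; auto. }
apply (iota_unique (V := R_CompleteNormedModule)); [|exact Hl].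
intros k Hk.
apply Req_le_aux; intros eps.
assert (He : 0 < eps / 2) by (destruct eps as [e He]; simpl; lra).
generalize (filter_and _ _ (proj2 Hl x Hlim (mkposreal _ He))
                           (proj2 Hk x Hlim (mkposreal _ He))).
intros [d Hd].
set (y := x + d / 2).
assert (Hdp : 0 < d) by apply cond_pos.
assert (Hy : ball x d y).
{ unfold ball; simpl; unfold AbsRing_ball, abs, minus, plus, opp; simpl.
  unfold y; rewrite Rabs_pos_eq; lra. }
assert (HD : nonneg_half_line y) by (unfold nonneg_half_line, y; lra).
destruct (Hd y Hy HD) as [A B]; revert A B.
unfold norm, minus, plus, opp, scal; simpl; unfold abs, mult; simpl.
replace (y + - x) with (d / 2) by (unfold y; ring).
rewrite (Rabs_pos_eq (d / 2)) by lra.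
intros A B.
assert (C : Rabs (d / 2 * (k - l)) <= eps * (d / 2)).
{ replace (d / 2 * (k - l)) with
    ((f y + - f x + - (d / 2 * l)) - (f y + - f x + - (d / 2 * k))) by ring.
  eapply Rle_trans; [apply Rabs_triang|]; rewrite Rabs_Ropp; lra. }
rewrite Rabs_mult, (Rabs_pos_eq (d / 2)) in C by lra.
apply Rmult_le_reg_l with (d / 2); lra.
Qed.

(* A function R^2 -> R is curried, as in Coquelicot's 2-d derivatives. *)
Definition partial_x (u : R -> R -> R) (x y : R) : R :=
  Derive (fun s : R => u s y) x.
Definition partial_y (u : R -> R -> R) (x y : R) : R :=
  Derive (fun s : R => u x s) y.

Definition grad (u : R -> R -> R) (x y : R) : R * R :=
  (partial_x u x y, partial_y u x y).

Definition div (V : R -> R -> R * R) (x y : R) : R :=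
  partial_x (fun s t : R => fst (V s t)) x y
  + partial_y (fun s t : R => snd (V s t)) x y.

Definition euclid_norm (p : R * R) : R := sqrt (fst p ^ 2 + snd p ^ 2).

Definition flux (g : R -> R) (p : R * R) : R * R :=
  if Req_EM_T (euclid_norm p) 0 then (0, 0)
  else (g^[1] (euclid_norm p) / euclid_norm p * fst p,
        g^[1] (euclid_norm p) / euclid_norm p * snd p).

(* ex_diff_n u n x y asks for the iterated partial derivatives up to order n at
   (x, y) and their joint continuity there; for all (x, y) this is C^n. *)
Definition class_C_plane (n : nat) (u : R -> R -> R) : Prop :=
  forall x y : R, ex_diff_n u n x y.

Definition affine (u : R -> R -> R) : Prop :=
  exists a b c : R, forall x y : R, u x y = a * x + b * y + c.

(* Main.v *)
Require Import Defs.
From Stdlib Require Import Reals Lra Psatz.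
From Coquelicot Require Import Coquelicot.
Open Scope R_scope.

(** Write p = grad u, t = |p|, H = D^2 u. The equation makes the energy-momentum
    tensor of u divergence free, so a symmetric matrix field J with eigenvalue
    g(t) + const along p and g(t) - t g'(t) + const across p is curl free,
    J = D Lambda. By (iv) the second eigenvalue is bounded, and the constant is
    chosen so that J >= 1; hence |Lambda(x)| >= |x|. Put r = |Lambda|^2 / 2.

    For a radial field X(p) one has div (cof H . X(p)) = det H . (div X)(p), and
    - det H controls |H|^2 because the equation makes H trace free up to positive
    weights. Taking X(p) = (Y(t) / t)^2 p with Y = t g' - g + g(0) + (t / (1 + t))^2,
    which is bounded by (iv), one gets
    |J cof H X|^2 <= K (div X) (- det H) det J. Multiply by a logarithmic cut-off in
    r: the cut-off error is at most a constant times det J / (ell^2 (1 + r)), and it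
    is, up to O(1 / ell) on {r < 2}, the divergence of h(r) cof J . Lambda with h of
    compact support, since div (h(r) cof J . Lambda) = 2 (r h)' det J. Letting ell
    tend to infinity gives det H = 0 where p <> 0, so H = 0. *)

(** * Continuously differentiable functions on the plane *)

(** The gradient of [u] is not known to be bounded and g'' tends to 0 at infinity, so there is no
    uniform ellipticity, and every estimate must hold uniformly in t. The map Lambda supplies the
    right geometry: det J dx is plain area in the Lambda-plane, so it grows quadratically in
    |Lambda|, which is just what a logarithmic cut-off tolerates in dimension two. No change of
    variables is made: the identity for div (h(r) cof J . Lambda) takes its place, and all is
    reduced to a pointwise lower bound for the divergence of one compactly supported field. The
    field X is found backwards. Since t^2 (Y / t)^2 = Y^2, its divergence is (Y^2)' / t = 2 Y Y' /
    t. The Legendre part of Y contributes g'' to Y' / t, the same factor with which the equation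
    weights the gradient direction. A lower bound for g'' at infinity is missing, so the rational
    summand of Y adds 2 / (1 + t)^3, which suffices for the mixed second derivative. *)

Definition C1 (F F1 F2 : R -> R -> R) : Prop :=
  forall x y : R, differentiable_pt_lim F x y (F1 x y) (F2 x y) /\
    continuity_2d_pt F1 x y /\ continuity_2d_pt F2 x y.

Lemma C1_is_derive_x (F F1 F2 : R -> R -> R) (x y : R) :
  C1 F F1 F2 -> is_derive (fun s : R => F s y) x (F1 x y).
Proof.
intros H; apply is_derive_Reals.
replace (F1 x y) with (F1 x y * 1 + F2 x y * 0) by ring.
apply (derivable_pt_lim_comp_2d F (fun s => s) (fun _ => y) x).
- apply H.
- apply derivable_pt_lim_id.
- apply derivable_pt_lim_const.
Qed.

Lemma C1_is_derive_y (F F1 F2 : R -> R -> R) (x y : R) :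
  C1 F F1 F2 -> is_derive (fun s : R => F x s) y (F2 x y).
Proof.
intros H; apply is_derive_Reals.
replace (F2 x y) with (F1 x y * 0 + F2 x y * 1) by ring.
apply (derivable_pt_lim_comp_2d F (fun _ => x) (fun s => s) y).
- apply H.
- apply derivable_pt_lim_const.
- apply derivable_pt_lim_id.
Qed.

Lemma C1_continuity (F F1 F2 : R -> R -> R) (x y : R) :
  C1 F F1 F2 -> continuity_2d_pt F x y.
Proof.
intros H; apply differentiable_continuity_pt.
exists (F1 x y), (F2 x y); apply H.
Qed.

Lemma C1_of_partials (F F1 F2 : R -> R -> R) :
  (forall x y, is_derive (fun s : R => F s y) x (F1 x y)) ->
  (forall x y, is_derive (fun s : R => F x s) y (F2 x y)) ->
  (forall x y, continuity_2d_pt F1 x y) ->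
  (forall x y, continuity_2d_pt F2 x y) -> C1 F F1 F2.
Proof.
intros H1 H2 K1 K2 x y; repeat split; try easy.
apply filterdiff_differentiable_pt_lim.
apply (is_derive_filterdiff F x y F1 (F2 x y)).
- apply filter_forall; intros [u v]; apply H1.
- apply H2.
- apply continuity_2d_pt_filterlim, K1.
Qed.

Lemma differentiable_pt_lim_eq (F : R -> R -> R) (x y a b a' b' : R) :
  differentiable_pt_lim F x y a b -> a = a' -> b = b' ->
  differentiable_pt_lim F x y a' b'.
Proof. now intros H -> ->. Qed.

Lemma C1_ext (F F1 F2 G G1 G2 : R -> R -> R) :
  (forall x y, F x y = G x y) -> (forall x y, F1 x y = G1 x y) ->
  (forall x y, F2 x y = G2 x y) -> C1 F F1 F2 -> C1 G G1 G2.
Proof.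
intros E E1 E2 H x y; destruct (H x y) as [A [B C]]; repeat split.
- rewrite <- E1, <- E2.
  apply differentiable_pt_lim_ext with (2 := A); apply locally_2d_forall; easy.
- apply continuity_2d_pt_ext with (2 := B); easy.
- apply continuity_2d_pt_ext with (2 := C); easy.
Qed.

Lemma C1_const (k : R) : C1 (fun _ _ => k) (fun _ _ => 0) (fun _ _ => 0).
Proof.
apply C1_of_partials; intros; try apply @is_derive_const;
  apply continuity_2d_pt_const.
Qed.

Lemma continuity_2d_pt_comp (F A B : R -> R -> R) (x y : R) :
  continuity_2d_pt F (A x y) (B x y) ->
  continuity_2d_pt A x y -> continuity_2d_pt B x y ->
  continuity_2d_pt (fun u v => F (A u v) (B u v)) x y.
Proof.
intros HF HA HB eps.
destruct (HF eps) as [d Hd].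
apply locally_2d_impl with (2 := HA d).
apply locally_2d_impl with (2 := HB d).
apply locally_2d_forall; intros u v H1 H2; now apply Hd.
Qed.

Lemma C1_comp (F F1 F2 A A1 A2 B B1 B2 : R -> R -> R) :
  C1 F F1 F2 -> C1 A A1 A2 -> C1 B B1 B2 ->
  C1 (fun x y => F (A x y) (B x y))
     (fun x y => F1 (A x y) (B x y) * A1 x y + F2 (A x y) (B x y) * B1 x y)
     (fun x y => F1 (A x y) (B x y) * A2 x y + F2 (A x y) (B x y) * B2 x y).
Proof.
intros HF HA HB x y; repeat split.
- apply differentiable_pt_lim_comp; [apply HF|apply HA|apply HB].
- apply continuity_2d_pt_plus; apply continuity_2d_pt_mult;
    try apply HA; try apply HB;
    apply continuity_2d_pt_comp; try apply HF;
    eapply C1_continuity; eassumption.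
- apply continuity_2d_pt_plus; apply continuity_2d_pt_mult;
    try apply HA; try apply HB;
    apply continuity_2d_pt_comp; try apply HF;
    eapply C1_continuity; eassumption.
Qed.

Lemma C1_plus (A A1 A2 B B1 B2 : R -> R -> R) :
  C1 A A1 A2 -> C1 B B1 B2 ->
  C1 (fun x y => A x y + B x y)
     (fun x y => A1 x y + B1 x y) (fun x y => A2 x y + B2 x y).
Proof.
intros HA HB.
assert (P : C1 (fun u v => u + v) (fun _ _ => 1) (fun _ _ => 1)).
{ apply C1_of_partials; intros; try apply continuity_2d_pt_const;
    auto_derive; auto; ring. }
eapply C1_ext; [| | |exact (C1_comp _ _ _ _ _ _ _ _ _ P HA HB)];
  intros; simpl; ring.
Qed.

Lemma C1_mult (A A1 A2 B B1 B2 : R -> R -> R) :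
  C1 A A1 A2 -> C1 B B1 B2 ->
  C1 (fun x y => A x y * B x y)
     (fun x y => A1 x y * B x y + A x y * B1 x y)
     (fun x y => A2 x y * B x y + A x y * B2 x y).
Proof.
intros HA HB.
assert (P : C1 (fun u v => u * v) (fun _ v => v) (fun u _ => u)).
{ apply C1_of_partials; intros;
    try apply continuity_2d_pt_id1; try apply continuity_2d_pt_id2;
    auto_derive; auto; ring. }
eapply C1_ext; [| | |exact (C1_comp _ _ _ _ _ _ _ _ _ P HA HB)];
  intros; simpl; ring.
Qed.

Lemma C1_scal (k : R) (A A1 A2 : R -> R -> R) :
  C1 A A1 A2 ->
  C1 (fun x y => k * A x y) (fun x y => k * A1 x y) (fun x y => k * A2 x y).
Proof.
intros HA.
eapply C1_ext; [| | |exact (C1_mult _ _ _ _ _ _ (C1_const k) HA)];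
  intros; simpl; ring.
Qed.

Lemma C1_minus (A A1 A2 B B1 B2 : R -> R -> R) :
  C1 A A1 A2 -> C1 B B1 B2 ->
  C1 (fun x y => A x y - B x y)
     (fun x y => A1 x y - B1 x y) (fun x y => A2 x y - B2 x y).
Proof.
intros HA HB.
eapply C1_ext; [| | |exact (C1_plus _ _ _ _ _ _ HA (C1_scal (-1) _ _ _ HB))];
  intros; simpl; ring.
Qed.

(** Regularity of [f] is asked only at values of [A]: the cut-offs below contain [ln (1 + r)] and
    are used for [r >= 0] only. *)
Lemma C1_comp1 (f f' : R -> R) (A A1 A2 : R -> R -> R) :
  (forall x y, is_derive f (A x y) (f' (A x y))) ->
  (forall x y, continuous f' (A x y)) ->
  C1 A A1 A2 ->
  C1 (fun x y => f (A x y))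
     (fun x y => f' (A x y) * A1 x y) (fun x y => f' (A x y) * A2 x y).
Proof.
intros Hf Cf HA x y; repeat split.
- generalize (differentiable_pt_lim_comp (fun u _ => f u) A A x y
    (f' (A x y)) 0 (A1 x y) (A2 x y) (A1 x y) (A2 x y)).
  rewrite !Rmult_0_l, !Rplus_0_r; intros K; apply K; try apply HA.
  apply differentiable_pt_lim_proj1_0, is_derive_Reals, Hf.
- apply continuity_2d_pt_mult; [|apply HA].
  apply continuity_1d_2d_pt_comp; [apply continuity_pt_filterlim, Cf|].
  eapply C1_continuity; eassumption.
- apply continuity_2d_pt_mult; [|apply HA].
  apply continuity_1d_2d_pt_comp; [apply continuity_pt_filterlim, Cf|].
  eapply C1_continuity; eassumption.
Qed.

Lemma continuity_2d_pt_section_x (F : R -> R -> R) (x y : R) :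
  continuity_2d_pt F x y -> continuous (fun s : R => F s y) x.
Proof.
intros H; apply continuity_pt_filterlim; intros e He.
destruct (H (mkposreal e He)) as [d Hd]; exists d; split; [apply cond_pos|].
intros z [_ Hz]; apply Hd; [exact Hz|].
rewrite Rminus_diag, Rabs_R0; apply cond_pos.
Qed.

Lemma continuity_2d_pt_section_y (F : R -> R -> R) (x y : R) :
  continuity_2d_pt F x y -> continuous (fun s : R => F x s) y.
Proof.
intros H; apply continuity_pt_filterlim; intros e He.
destruct (H (mkposreal e He)) as [d Hd]; exists d; split; [apply cond_pos|].
intros z [_ Hz]; apply Hd; [|exact Hz].
rewrite Rminus_diag, Rabs_R0; apply cond_pos.
Qed.

Lemma is_derive_RInt_param_C1 (F F1 F2 : R -> R -> R) (a b y : R) :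
  C1 F F1 F2 ->
  is_derive (fun t : R => RInt (fun s => F s t) a b) y
            (RInt (fun s => F2 s y) a b).
Proof.
intros H.
assert (E : forall s t, Derive (fun z => F s z) t = F2 s t).
{ intros s t; apply is_derive_unique, (C1_is_derive_y F F1 F2); exact H. }
replace (RInt (fun s => F2 s y) a b)
  with (RInt (fun s => Derive (fun z => F s z) y) a b)
  by (apply RInt_ext; intros; apply E).
apply (is_derive_RInt_param (fun t s => F s t) a b y).
- apply filter_forall; intros t s _; exists (F2 s t).
  apply (C1_is_derive_y F F1 F2); exact H.
- intros t _.
  apply continuity_2d_pt_ext with (fun u v => F2 v u); [intros; now rewrite E|].
  intros eps; destruct (proj2 (proj2 (H t y)) eps) as [d Hd]; exists d.
  intros u v Hu Hv; now apply Hd.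
- apply filter_forall; intros t; apply (@ex_RInt_continuous R_CompleteNormedModule).
  intros z _; apply continuity_2d_pt_section_x, (C1_continuity F F1 F2); exact H.
Qed.

(** Integrate [P] along the x-axis, then [Q] vertically. The y-derivative is [Q] at once; in the
    x-derivative, closedness turns the differentiated vertical integral into [P x y - P x 0]. *)
Lemma poincare (P P1 P2 Q Q1 Q2 : R -> R -> R) :
  C1 P P1 P2 -> C1 Q Q1 Q2 -> (forall x y, P2 x y = Q1 x y) ->
  exists F, C1 F P Q /\ F 0 0 = 0.
Proof.
intros HP HQ E.
assert (cP : forall x y, continuity_2d_pt P x y)
  by (intros; eapply C1_continuity; exact HP).
assert (cQ : forall x y, continuity_2d_pt Q x y)
  by (intros; eapply C1_continuity; exact HQ).
(* [is_derive_RInt_param_C1] differentiates in the second variable, so [Q] is needed with its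
   variables swapped. *)
assert (HQ' : C1 (fun t s => Q s t) (fun t s => Q2 s t) (fun t s => Q1 s t)).
{ apply C1_of_partials; intros.
  - apply (C1_is_derive_y Q Q1 Q2); exact HQ.
  - apply (C1_is_derive_x Q Q1 Q2); exact HQ.
  - intros eps; destruct (proj2 (proj2 (HQ y x)) eps) as [d Hd]; exists d.
    intros u v Hu Hv; now apply Hd.
  - intros eps; destruct (proj1 (proj2 (HQ y x)) eps) as [d Hd]; exists d.
    intros u v Hu Hv; now apply Hd. }
exists (fun x y => RInt (fun s => P s 0) 0 x + RInt (fun t => Q x t) 0 y).
split; [|rewrite !RInt_point; unfold zero; simpl; ring].
apply C1_of_partials; try easy; intros x y.
- assert (K : RInt (fun t => Q1 x t) 0 y = P x y - P x 0).
  { rewrite (RInt_ext _ (fun t => P2 x t)) by (intros; now rewrite E).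
    apply is_RInt_unique.
    apply (is_RInt_derive (fun t => P x t) (fun t => P2 x t)); intros t _.
    - apply (C1_is_derive_y P P1 P2); exact HP.
    - apply continuity_2d_pt_section_y, HP. }
  replace (P x y) with (P x 0 + RInt (fun t => Q1 x t) 0 y) by (rewrite K; ring).
  apply (is_derive_plus (fun s => RInt (fun s0 => P s0 0) 0 s)
           (fun s => RInt (fun t => Q s t) 0 y)).
  + apply (is_derive_RInt (fun s => P s 0) (fun s => RInt (fun s0 => P s0 0) 0 s) 0).
    * apply filter_forall; intros z; apply (@RInt_correct R_CompleteNormedModule).
      apply (@ex_RInt_continuous R_CompleteNormedModule); intros w _.
      now apply continuity_2d_pt_section_x.
    * now apply continuity_2d_pt_section_x.
  + exact (is_derive_RInt_param_C1 _ _ _ 0 y x HQ').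
- replace (Q x y) with (0 + Q x y) by ring.
  apply (is_derive_plus (fun s => RInt (fun s0 => P s0 0) 0 x)
           (fun s => RInt (fun t => Q x t) 0 s)).
  + apply @is_derive_const.
  + apply (is_derive_RInt (fun t => Q x t) (fun s => RInt (fun t => Q x t) 0 s) 0).
    * apply filter_forall; intros z; apply (@RInt_correct R_CompleteNormedModule).
      apply (@ex_RInt_continuous R_CompleteNormedModule); intros w _.
      now apply continuity_2d_pt_section_y.
    * now apply continuity_2d_pt_section_y.
Qed.

(** * Divergence of compactly supported fields *)

Lemma increment_ge (F f : R -> R) (k a b : R) :
  (forall x, is_derive F x (f x)) -> a <= b ->
  (forall x, a < x < b -> k <= f x) -> k * (b - a) <= F b - F a.
Proof.
intros HF [Hab | ->] Hk; [|lra].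
destruct (MVT_cor2 F f a b Hab) as [c [-> Hc]].
- intros; now apply is_derive_Reals.
- apply Rmult_le_compat_r; [lra|now apply Hk].
Qed.

(** Cut the interval at [- l], [c], [d], [l] and use the mean value theorem with lower bounds [0],
    [- e], [m - e], [- e], [0] for the derivative. It serves for each row and then for the rows
    together. *)
Lemma increment_ge_pieces (F f : R -> R) (L l c d m e : R) :
  (forall x, is_derive F x (f x)) ->
  - L <= - l -> - l <= c -> c <= d -> d <= l -> l <= L ->
  (forall x, l < Rabs x -> 0 <= f x) ->
  (forall x, - e <= f x) ->
  (forall x, c <= x <= d -> m - e <= f x) ->
  m * (d - c) <= F L - F (- L) + e * (2 * l).
Proof.
intros HF H1 H2 H3 H4 H5 Hout He Hm.
generalize (increment_ge F f 0 (- L) (- l) HF H1)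
  (increment_ge F f (- e) (- l) c HF H2)
  (increment_ge F f (m - e) c d HF H3)
  (increment_ge F f (- e) d l HF H4)
  (increment_ge F f 0 l L HF H5).
intros K1 K2 K3 K4 K5.
assert (L1 := K1 (fun x Hx => Hout x ltac:(rewrite Rabs_left1; lra))).
assert (L2 := K2 (fun x _ => He x)).
assert (L3 := K3 (fun x Hx => Hm x ltac:(lra))).
assert (L4 := K4 (fun x _ => He x)).
assert (L5 := K5 (fun x Hx => Hout x ltac:(rewrite Rabs_pos_eq; lra))).
lra.
Qed.

(* The divergence integrates to zero, so a positive lower bound on a square
   must be compensated by the negative part. *)
Lemma divergence_balance (V V1 V2 W W1 W2 : R -> R -> R) (L l a b s m e : R) :
  C1 V V1 V2 -> C1 W W1 W2 ->
  (forall x y, L <= Rabs x \/ L <= Rabs y -> V x y = 0 /\ W x y = 0) ->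
  0 <= e -> 0 <= s -> Rabs a + s <= l -> Rabs b + s <= l -> l <= L ->
  (forall x y, l < Rabs x \/ l < Rabs y -> 0 <= V1 x y + W2 x y) ->
  (forall x y, - e <= V1 x y + W2 x y) ->
  (forall x y, a - s <= x <= a + s -> b - s <= y <= b + s ->
     m - e <= V1 x y + W2 x y) ->
  m * (2 * s) * (2 * s) <= e * (2 * l) * (2 * l).
Proof.
intros HV HW Hsupp He Hs Ha Hb HL Hout Hlow Hm.
assert (Ha' : - l <= a - s /\ a + s <= l).
{ generalize (Rle_abs a) (Rle_abs (- a)); rewrite Rabs_Ropp; lra. }
assert (Hb' : - l <= b - s /\ b + s <= l).
{ generalize (Rle_abs b) (Rle_abs (- b)); rewrite Rabs_Ropp; lra. }
assert (HL0 : 0 <= L) by lra.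
assert (edge : L <= Rabs L /\ L <= Rabs (- L)).
{ rewrite Rabs_Ropp, Rabs_pos_eq; lra. }
assert (cV : forall x y, continuity_2d_pt V1 x y) by (intros; apply HV).
assert (cW : forall x y, continuity_2d_pt W2 x y) by (intros; apply HW).
set (f y := RInt (fun x => W2 x y) (- L) L).
set (G y x := RInt (fun t => V1 t y + W2 t y) (- L) x).
assert (dG : forall y x, is_derive (G y) x (V1 x y + W2 x y)).
{ intros y x.
  assert (cont : forall z, continuous (fun t => V1 t y + W2 t y) z).
  { intros z; apply (continuous_plus (fun t => V1 t y) (fun t => W2 t y));
      now apply continuity_2d_pt_section_x. }
  apply (is_derive_RInt (fun t => V1 t y + W2 t y) (G y) (- L)); [|apply cont].
  apply filter_forall; intros z; apply (@RInt_correct R_CompleteNormedModule).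
  now apply (@ex_RInt_continuous R_CompleteNormedModule). }
(* [V] vanishes at both ends of a row, so its part integrates to 0, and [f y] is the integral of the
   whole divergence over the row. *)
assert (fG : forall y, f y = G y L - G y (- L)).
{ intros y; unfold f, G; rewrite RInt_point.
  assert (I1 : is_RInt (fun t => V1 t y) (- L) L 0).
  { replace 0 with (minus (V L y) (V (- L) y)).
    - apply (is_RInt_derive (fun t => V t y) (fun t => V1 t y)); intros t _.
      + apply (C1_is_derive_x V V1 V2); exact HV.
      + now apply continuity_2d_pt_section_x.
    - rewrite (proj1 (Hsupp L y (or_introl (proj1 edge)))).
      rewrite (proj1 (Hsupp (- L) y (or_introl (proj2 edge)))).
      unfold minus, plus, opp; simpl; ring. }
  rewrite (RInt_plus (fun t => V1 t y) (fun t => W2 t y)).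
  - rewrite (is_RInt_unique _ _ _ _ I1).
    symmetry; etransitivity; [apply Rminus_0_r|apply Rplus_0_l].
  - exists 0; exact I1.
  - apply (@ex_RInt_continuous R_CompleteNormedModule); intros z _.
    now apply continuity_2d_pt_section_x. }
assert (dF : forall y, is_derive (fun t => RInt (fun x => W x t) (- L) L) y (f y)).
{ intros y; apply is_derive_RInt_param_C1 with W1; exact HW. }
assert (zero_edge : forall y, L <= Rabs y -> RInt (fun x => W x y) (- L) L = 0).
{ intros y Hy; rewrite (RInt_ext _ (fun _ => 0)).
  - rewrite RInt_const; apply Rmult_0_r.
  - intros x _; apply (Hsupp x y); now right. }
(* The same estimate in [y]: each row may lose [e * (2 * l)], and rows through the square gain
   [m * (2 * s)]. *)
generalize (increment_ge_pieces _ f L l (b - s) (b + s) (m * (2 * s)) (e * (2 * l)) dF).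
rewrite (zero_edge L), (zero_edge (- L)) by apply edge.
intros K; assert (K' : m * (2 * s) * (b + s - (b - s)) <=
  0 - 0 + e * (2 * l) * (2 * l)); [|lra].
apply K; try lra; clear K.
- intros y Hy; rewrite fG.
  generalize (increment_ge (G y) _ 0 (- L) L (dG y)); intros I.
  assert (J := I ltac:(lra) (fun x _ => Hout x y (or_intror Hy))); lra.
- intros y; rewrite fG.
  (* An arbitrary row need not meet the square: the middle piece shrinks to the point 0, with gain
     0. *)
  assert (J : 0 * (0 - 0) <= G y L - G y (- L) + e * (2 * l)); [|lra].
  apply (increment_ge_pieces (G y) _ L l 0 0 0 e (dG y)); try lra; intros x.
  + intros Hx; apply Hout; now left.
  + apply Hlow.
  + intros _; generalize (Hlow x y); lra.
- intros y Hy; rewrite fG.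
  assert (J : m * (a + s - (a - s)) <= G y L - G y (- L) + e * (2 * l)); [|lra].
  apply (increment_ge_pieces (G y) _ L l (a - s) (a + s) m e (dG y)); try lra.
  + intros x Hx; apply Hout; now left.
  + intros x; apply Hlow.
  + intros x Hx; now apply Hm.
Qed.

(** * The energy density *)

(** All fields concern [t > 0], where derivatives are two-sided; what happens at 0 is encoded in the
    bounds. The quantity in [ed_legendre] is the Legendre transform of g at g'(t), normalised to
    vanish at t = 0; its boundedness is hypothesis (iv). *)
Record energy_density (g g1 g2 : R -> R) (c0 c L : R) : Prop := {
  ed_c0 : 0 < c0;
  ed_c : 0 < c;
  ed_L : 0 <= L;
  ed_g1 : forall t, 0 < t -> is_derive g t (g1 t);
  ed_g2 : forall t, 0 < t -> is_derive g1 t (g2 t);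
  ed_cont : forall t, 0 < t -> continuous g2 t;
  ed_g2_pos : forall t, 0 < t -> 0 < g2 t <= c;
  ed_g1_lower : forall t, 0 < t -> c0 * t <= g1 t * (1 + t);
  ed_g1_upper : forall t, 0 < t -> g1 t <= c * t;
  ed_g_ge : forall t, 0 < t -> g 0 <= g t;
  ed_g_le : forall t, 0 < t -> g t - g 0 <= t * g1 t;
  ed_legendre : forall t, 0 < t -> t * g1 t - g t + g 0 <= L }.

Lemma is_derive_within_interior (f : R -> R) (x l : R) :
  0 < x -> is_derive_within nonneg_half_line f x l -> is_derive f x l.
Proof.
intros Hx [Hlin H]; split; [exact Hlin|].
intros z Hz eps.
assert (Hz' : is_filter_lim (within nonneg_half_line (locally x)) z).
{ intros P HP; unfold within.
  generalize (Hz P HP); apply filter_imp; auto. }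
assert (pos : locally x nonneg_half_line).
{ exists (mkposreal x Hx); intros y Hy.
  apply Rabs_lt_between in Hy; unfold nonneg_half_line, minus, plus, opp in *.
  simpl in *; lra. }
generalize (filter_and _ _ pos (H z Hz' eps)).
apply filter_imp; intros y [Dy Hy]; exact (Hy Dy).
Qed.

(** Composition with [Rabs] turns one-sided continuity at 0 into ordinary continuity, without using
    values of [f] at negative arguments. *)
Lemma continuous_on_half_line_Rabs (f : R -> R) (x : R) :
  continuous_on nonneg_half_line f -> continuous (fun t => f (Rabs t)) x.
Proof.
intros H.
apply filterlim_comp with (within nonneg_half_line (locally (Rabs x))).
- intros P HP; generalize (continuous_Rabs x _ HP); unfold filtermap.
  apply filter_imp; intros y Hy; apply Hy, Rabs_pos.
- apply H, Rabs_pos.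
Qed.

(** The mean value theorem is applied on [[s, T]] with [s > 0] so small that [F s] would still
    exceed [F T], since only continuity is available at 0. *)
Lemma nondecreasing_from_0 (F F' : R -> R) (T : R) :
  continuous (fun t => F (Rabs t)) 0 ->
  (forall t, 0 < t -> is_derive F t (F' t)) -> 0 < T ->
  (forall t, 0 < t < T -> 0 <= F' t) -> F 0 <= F T.
Proof.
intros HC HD HT Hpos.
destruct (Rle_or_lt (F 0) (F T)) as [h|h]; [exact h|exfalso].
assert (He : 0 < F 0 - F T) by lra.
destruct (proj2 (continuity_pt_filterlim _ _) HC _ He) as [d [Hd Hc]].
set (s := Rmin (d / 2) (T / 2)).
assert (Hs : 0 < s /\ s <= d / 2 /\ s <= T / 2).
{ repeat split; [apply Rmin_pos; lra|apply Rmin_l|apply Rmin_r]. }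
assert (K := Hc s); unfold dist in K; simpl in K; unfold Rdist in K.
rewrite Rabs_R0, Rminus_0_r, !(Rabs_pos_eq s) in K by lra.
assert (K' : Rabs (F s - F 0) < F 0 - F T).
{ apply K; split; [|lra]; split; [exact I|lra]. }
apply Rabs_lt_between in K'.
destruct (MVT_cor2 F F' s T) as [z [E Hz]]; [lra| |].
- intros z Hz; apply is_derive_Reals, HD; lra.
- assert (0 <= F' z * (T - s)); [apply Rmult_le_pos; [apply Hpos|]|]; lra.
Qed.

Lemma energy_density_intro (g : R -> R) :
  class_C_within nonneg_half_line 3 g -> g^[1] 0 = 0 ->
  (forall t : R, 0 <= t -> 0 < g^[2] t) ->
  (exists mu c : R, 1 < mu /\ 0 < c /\
     forall t : R, 0 <= t -> g^[2] t <= c * Rpower (1 + t) (- mu)) ->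
  ex_RInt_gen (fun s : R => s * g^[2] s) (at_point 0) (Rbar_locally p_infty) ->
  exists c0 c L, energy_density g g^[1] g^[2] c0 c L.
Proof.
intros [Hex Hcont] g10 g2pos [mu [c [Hmu [Hc Hdec]]]] Hint.
set (g1 := g^[1]) in *; set (g2 := g^[2]) in *.
assert (D0 : forall t, 0 < t -> is_derive g t (g1 t)).
{ intros t Ht; destruct (Hex 0%nat ltac:(auto) t ltac:(red; lra)) as [l Hl].
  assert (E : g1 t = l)
    by (apply is_derive_within_half_line_unique; [lra|exact Hl]).
  rewrite E; now apply is_derive_within_interior. }
assert (D1 : forall t, 0 < t -> is_derive g1 t (g2 t)).
{ intros t Ht; destruct (Hex 1%nat ltac:(auto) t ltac:(red; lra)) as [l Hl].
  assert (E : g2 t = l)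
    by (apply is_derive_within_half_line_unique; [lra|exact Hl]).
  rewrite E; now apply is_derive_within_interior. }
assert (C0 : forall t, continuous (fun t => g (Rabs t)) t)
  by (intros t; apply continuous_on_half_line_Rabs, (Hcont 0%nat); auto).
assert (C1' : forall t, continuous (fun t => g1 (Rabs t)) t)
  by (intros t; apply continuous_on_half_line_Rabs, (Hcont 1%nat); auto).
assert (C2 : forall t, continuous (fun t => g2 (Rabs t)) t)
  by (intros t; apply continuous_on_half_line_Rabs, (Hcont 2%nat); auto).
assert (g2le : forall t, 0 < t -> g2 t <= c).
{ intros t Ht; apply Rle_trans with (1 := Hdec t ltac:(lra)).
  rewrite <- (Rmult_1_r c) at 2; apply Rmult_le_compat_l; [lra|].
  apply Rle_trans with (Rpower (1 + t) 0); [apply Rle_Rpower|rewrite Rpower_O]; lra. }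
assert (cabs : forall x, continuous Rabs x) by exact continuous_Rabs.
assert (g1up : forall t, 0 < t -> g1 t <= c * t).
{ intros t Ht.
  assert (K : c * 0 - g1 0 <= c * t - g1 t); [|unfold g1 in *; lra].
  apply (nondecreasing_from_0 (fun t => c * t - g1 t) (fun t => c - g2 t)); auto.
  - apply (continuous_minus (fun t => c * Rabs t) (fun t => g1 (Rabs t))); auto.
    now apply (continuous_scal_r c Rabs).
  - intros s Hs; replace (c - g2 s) with (minus (c * 1) (g2 s))
      by (unfold minus, plus, opp; simpl; ring).
    apply (is_derive_minus (fun t => c * t) g1); auto.
    apply is_derive_scal, @is_derive_id.
  - intros s Hs; generalize (g2le s ltac:(lra)); lra. }
assert (incr : forall s t, 0 < s -> s <= t -> g1 s <= g1 t).
{ intros s t Hs [Hst | ->]; [|lra].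
  destruct (MVT_cor2 g1 g2 s t Hst) as [z [E Hz]].
  - intros z Hz; apply is_derive_Reals, D1; lra.
  - generalize (g2pos z ltac:(lra)); nra. }
(* By continuity g'' exceeds half of g''(0) near 0, which gives a linear lower bound for g' there;
   beyond [d0] monotonicity of g' keeps the value reached. *)
assert (g1low : exists d0, 0 < d0 /\
  forall t, 0 < t -> g2 0 / 2 * Rmin t d0 <= g1 t).
{ assert (p0 := g2pos 0 ltac:(lra)).
  destruct (proj2 (continuity_pt_filterlim _ _) (C2 0) (g2 0 / 2)) as [d [Hd K]];
    [lra|].
  unfold dist in K; simpl in K; unfold Rdist in K; rewrite Rabs_R0 in K.
  assert (near : forall t, 0 < t <= d / 2 -> g2 0 / 2 * t <= g1 t).
  { intros t Ht.
    assert (J : g1 0 - g2 0 / 2 * 0 <= g1 t - g2 0 / 2 * t);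
      [|unfold g1 in *; lra].
    apply (nondecreasing_from_0 (fun t => g1 t - g2 0 / 2 * t)
             (fun t => g2 t - g2 0 / 2)); try lra.
    - apply (continuous_minus (fun t => g1 (Rabs t)) (fun t => g2 0 / 2 * Rabs t));
        auto.
      now apply (continuous_scal_r (g2 0 / 2) Rabs).
    - intros s Hs; replace (g2 s - g2 0 / 2) with (minus (g2 s) (g2 0 / 2 * 1))
        by (unfold minus, plus, opp; simpl; ring).
      apply (is_derive_minus g1 (fun t => g2 0 / 2 * t)); auto.
      apply is_derive_scal, @is_derive_id.
    - intros s Hs; assert (Q := K s).
      rewrite Rminus_0_r, (Rabs_pos_eq s) in Q by lra.
      assert (Q' : Rabs (g2 s - g2 0) < g2 0 / 2).
      { apply Q; split; [|lra]; split; [exact I|lra]. }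
      apply Rabs_lt_between in Q'; lra. }
  exists (d / 2); split; [lra|]; intros t Ht.
  destruct (Rle_or_lt t (d / 2)) as [h|h].
  - rewrite Rmin_left by lra; apply near; lra.
  - rewrite Rmin_right by lra.
    apply Rle_trans with (g1 (d / 2)); [apply near|apply incr]; lra. }
destruct g1low as [d0 [Hd0 g1low]].
assert (p0 := g2pos 0 ltac:(lra)).
assert (g1pos : forall t, 0 < t -> 0 < g1 t).
{ intros t Ht; apply Rlt_le_trans with (2 := g1low t Ht).
  apply Rmult_lt_0_compat; [lra|now apply Rmin_pos]. }
assert (gge : forall t, 0 < t -> g 0 <= g t).
{ intros t Ht; apply (nondecreasing_from_0 g g1); auto.
  intros s Hs; apply Rlt_le, g1pos; lra. }
set (Y t := t * g1 t - g t).
assert (DY : forall t, 0 < t -> is_derive Y t (t * g2 t)).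
{ intros t Ht.
  replace (t * g2 t) with (minus (plus (mult 1 (g1 t)) (mult t (g2 t))) (g1 t))
    by (unfold minus, plus, opp, mult; simpl; ring).
  apply (is_derive_minus (fun t => t * g1 t) g); [|now apply D0].
  apply (is_derive_mult (fun t => t) g1); [apply @is_derive_id|now apply D1|].
  intros; apply Rmult_comm. }
assert (Yge : forall t, 0 < t -> Y 0 <= Y t).
{ intros t Ht; apply (nondecreasing_from_0 Y (fun t => t * g2 t)); auto.
  - apply (continuous_minus (fun t => Rabs t * g1 (Rabs t)) (fun t => g (Rabs t)));
      auto.
    now apply (continuous_mult Rabs (fun t => g1 (Rabs t))).
  - intros s Hs; apply Rmult_le_pos; [lra|apply Rlt_le, g2pos; lra]. }
assert (Y0 : Y 0 = - g 0) by (unfold Y; ring).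
assert (cg2 : forall t, 0 < t -> continuous g2 t).
{ intros t Ht; apply continuous_ext_loc with (fun t => g2 (Rabs t)); [|apply C2].
  exists (mkposreal t Ht); intros y Hy; apply Rabs_lt_between in Hy.
  unfold minus, plus, opp in Hy; simpl in Hy.
  rewrite Rabs_pos_eq; [reflexivity|lra]. }
assert (Ymono : forall s t, 0 < s -> s <= t -> Y s <= Y t).
{ intros s t Hs [Hst | ->]; [|lra].
  destruct (MVT_cor2 Y (fun t => t * g2 t) s t Hst) as [z [E Hz]].
  - intros z Hz; apply is_derive_Reals, DY; lra.
  - generalize (g2pos z ltac:(lra)); intros q.
    assert (0 <= z * g2 z * (t - s)); [|lra].
    apply Rmult_le_pos; [apply Rmult_le_pos|]; lra. }
(* The integrand s g''(s) is the derivative of [Y]. Convergence controls only integrals up to a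
   large endpoint, so [t] is first moved up to such a [y] by monotonicity. The split at 1 is there
   because [Y] is differentiated only at positive points; the piece on [0, 1] is nonnegative and
   dropped. *)
assert (YL : exists L, 0 <= L /\ forall t, 0 < t -> Y t + g 0 <= L).
{ destruct Hint as [l Hl].
  destruct (Hl (ball l 1) (locally_ball l (mkposreal 1 Rlt_0_1)))
    as [P Q HP [M HM] HPQ].
  set (y0 := Rmax 1 (M + 1)).
  exists (Y 1 + g 0 + Rabs l + 1); split.
  { generalize (Yge 1 Rlt_0_1) (Rabs_pos l); lra. }
  intros t Ht.
  set (y := Rmax t y0).
  assert (hy : t <= y /\ 1 <= y /\ M < y).
  { unfold y, y0; generalize (Rmax_l t (Rmax 1 (M + 1)))
      (Rmax_r t (Rmax 1 (M + 1))) (Rmax_l 1 (M + 1)) (Rmax_r 1 (M + 1)); lra. }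
  destruct (HPQ 0 y HP (HM y ltac:(lra))) as [I0 [HI Hball]]; simpl in HI.
  assert (eI : ex_RInt (fun s => s * g2 s) 0 y) by (exists I0; exact HI).
  assert (e1 := ex_RInt_Chasles_1 _ 0 1 y ltac:(lra) eI).
  assert (e2 := ex_RInt_Chasles_2 _ 0 1 y ltac:(lra) eI).
  assert (E := RInt_Chasles _ 0 1 y e1 e2).
  rewrite (is_RInt_unique _ _ _ _ HI) in E.
  assert (E2 : RInt (fun s => s * g2 s) 1 y = Y y - Y 1).
  { apply is_RInt_unique, (is_RInt_derive Y); intros s Hs;
      rewrite Rmin_left, Rmax_right in Hs by lra.
    - apply DY; lra.
    - apply (continuous_mult (fun s => s) g2); [apply continuous_id|].
      apply cg2; lra. }
  assert (E1 : 0 <= RInt (fun s => s * g2 s) 0 1).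
  { apply RInt_ge_0; [lra|exact e1|]; intros s Hs.
    apply Rmult_le_pos; [lra|apply Rlt_le, g2pos; lra]. }
  assert (B : Rabs (I0 - l) < 1) by exact Hball.
  apply Rabs_lt_between in B.
  rewrite E2 in E; unfold plus in E; simpl in E.
  generalize (Ymono t y Ht ltac:(lra)) (Rle_abs l); lra. }
destruct YL as [L [HL YL]].
(* This [c0] works because [Rmin t d0 * (1 + t) >= Rmin 1 d0 * t]. *)
exists (g2 0 / 2 * Rmin 1 d0), c, L; constructor; auto.
- apply Rmult_lt_0_compat; [lra|apply Rmin_pos; lra].
- intros t Ht; split; [apply g2pos; lra|auto].
- intros t Ht.
  apply Rle_trans with (g2 0 / 2 * Rmin t d0 * (1 + t));
    [|apply Rmult_le_compat_r; [lra|auto]].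
  rewrite !Rmult_assoc; apply Rmult_le_compat_l; [lra|].
  generalize (Rmin_l 1 d0) (Rmin_r 1 d0); apply (Rmin_case t d0); intros; nra.
- intros t Ht; generalize (Yge t Ht); unfold Y in *; lra.
Qed.

(** * Radial functions *)

Definition rad (p q : R) : R := sqrt (p ^ 2 + q ^ 2).

Lemma pow2_le_inv (a b : R) : 0 <= b -> a ^ 2 <= b ^ 2 -> a <= b.
Proof. intros; nra. Qed.

Lemma rad_sqr (p q : R) : rad p q ^ 2 = p ^ 2 + q ^ 2.
Proof. unfold rad; rewrite pow2_sqrt; nra. Qed.

Lemma rad_pos (p q : R) : 0 <= rad p q.
Proof. apply sqrt_pos. Qed.

Lemma rad_0 : rad 0 0 = 0.
Proof. unfold rad; replace (0 ^ 2 + 0 ^ 2) with 0 by ring; apply sqrt_0. Qed.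

Lemma rad_eq_0 (p q : R) : rad p q = 0 -> p = 0 /\ q = 0.
Proof. intros H; generalize (rad_sqr p q); rewrite H; nra. Qed.

Lemma rad_bounds (p q : R) : Rabs p <= rad p q /\ Rabs q <= rad p q.
Proof.
generalize (rad_sqr p q) (rad_pos p q); intros E P.
split; (apply pow2_le_inv; [exact P|rewrite E, pow2_abs; nra]).
Qed.

Lemma rad_le (p q : R) : rad p q <= 2 * Rmax (Rabs p) (Rabs q).
Proof.
generalize (rad_sqr p q) (Rmax_l (Rabs p) (Rabs q)) (Rmax_r (Rabs p) (Rabs q))
  (Rabs_pos p) (Rabs_pos q) (pow2_abs p) (pow2_abs q); intros.
apply pow2_le_inv; [nra|].
rewrite H; rewrite <- H4, <- H5; nra.
Qed.

Lemma rad_differentiable (m : R -> R) (p q l : R) :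
  rad p q <> 0 -> is_derive m (rad p q) l ->
  differentiable_pt_lim (fun x y => m (rad x y)) p q
    (l * p / rad p q) (l * q / rad p q).
Proof.
intros Hr Hm.
assert (pos : 0 < p ^ 2 + q ^ 2).
{ rewrite <- rad_sqr; generalize (rad_pos p q); nra. }
assert (S : differentiable_pt_lim (fun x y => x ^ 2 + y ^ 2) p q (2 * p) (2 * q)).
{ assert (H : C1 (fun x y => x ^ 2 + y ^ 2) (fun x _ => 2 * x) (fun _ y => 2 * y)).
  { apply C1_of_partials; intros.
    - auto_derive; auto; ring.
    - auto_derive; auto; ring.
    - apply continuity_2d_pt_mult;
        [apply continuity_2d_pt_const|apply continuity_2d_pt_id1].
    - apply continuity_2d_pt_mult;
        [apply continuity_2d_pt_const|apply continuity_2d_pt_id2]. }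
  apply H. }
assert (D : is_derive (fun s => m (sqrt s)) (p ^ 2 + q ^ 2) (l / (2 * rad p q))).
{ replace (l / (2 * rad p q)) with (scal (/ (2 * rad p q)) l)
    by (unfold scal, Rdiv; simpl; unfold mult; simpl; ring).
  apply (is_derive_comp m sqrt); [exact Hm|].
  apply is_derive_Reals; now apply derivable_pt_lim_sqrt. }
apply (differentiable_pt_lim_eq _ _ _ _ _ _ _
  (differentiable_pt_lim_comp (fun s _ => m (sqrt s)) _ _ p q _ 0 _ _ _ _
    (differentiable_pt_lim_proj1_0 _ _ (p ^ 2 + q ^ 2) _
       (proj1 (is_derive_Reals _ _ _) D)) S S)); field; exact Hr.
Qed.

(** The triangle inequality, obtained from Cauchy-Schwarz, makes [rad] Lipschitz. *)
Lemma rad_continuity (p q : R) : continuity_2d_pt rad p q.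
Proof.
intros eps.
exists (mkposreal (eps / 2) ltac:(generalize (cond_pos eps); lra)).
intros u v Hu Hv; simpl in *.
assert (T : forall a b c d, rad (a + c) (b + d) <= rad a b + rad c d).
{ intros a b c d; apply pow2_le_inv.
  - generalize (rad_pos a b) (rad_pos c d); lra.
  - generalize (rad_sqr a b) (rad_sqr c d) (rad_sqr (a + c) (b + d))
      (rad_pos a b) (rad_pos c d); intros E1 E2 E3 P1' P2'.
    assert (a * c + b * d <= rad a b * rad c d); [|nra].
    destruct (Rle_or_lt (a * c + b * d) 0);
      [generalize (Rmult_le_pos _ _ P1' P2'); lra|].
    apply pow2_le_inv; [now apply Rmult_le_pos|].
    rewrite Rpow_mult_distr, E1, E2; generalize (pow2_ge_0 (a * d - b * c)); nra. }
assert (S : rad (p - u) (q - v) = rad (u - p) (v - q)).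
{ unfold rad; f_equal; ring. }
generalize (T p q (u - p) (v - q)) (T u v (p - u) (q - v)) (rad_le (u - p) (v - q)).
rewrite S.
replace (p + (u - p)) with u by ring; replace (q + (v - q)) with v by ring.
replace (u + (p - u)) with p by ring; replace (v + (q - v)) with q by ring.
assert (Rmax (Rabs (u - p)) (Rabs (v - q)) < eps / 2) by (now apply Rmax_lub_lt).
intros; apply Rabs_lt_between; lra.
Qed.

Lemma radial_mult_differentiable (m : R -> R) (A A1 A2 : R -> R -> R) (p q l : R) :
  C1 A A1 A2 -> rad p q <> 0 -> is_derive m (rad p q) l ->
  differentiable_pt_lim (fun x y => m (rad x y) * A x y) p q
    (l * p / rad p q * A p q + m (rad p q) * A1 p q)
    (l * q / rad p q * A p q + m (rad p q) * A2 p q).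
Proof.
intros HA Hr Hm.
assert (P : C1 (fun u v => u * v) (fun _ v => v) (fun u _ => u)).
{ apply C1_of_partials; intros;
    try apply continuity_2d_pt_id1; try apply continuity_2d_pt_id2;
    auto_derive; auto; ring. }
apply (differentiable_pt_lim_eq _ _ _ _ _ _ _
  (differentiable_pt_lim_comp (fun u v => u * v) _ _ p q _ _ _ _ _ _
    (proj1 (P (m (rad p q)) (A p q))) (rad_differentiable m p q l Hr Hm)
    (proj1 (HA p q)))); ring.
Qed.

(** The factor [m] may be singular or have a junk value at 0. Away from the origin this is the chain
    rule; at the origin the quadratic bound on the product gives differentiability with zero
    gradient, and the linear bounds make the partials continuous there. The three equations at 0 say
    that the value of [m 0] does no harm. *)
Lemma radial_C1 (m m' : R -> R) (A A1 A2 : R -> R -> R) (B : R) :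
  C1 A A1 A2 ->
  (forall t, 0 < t -> is_derive m t (m' t)) ->
  (forall t, 0 < t -> continuous m' t) ->
  m 0 * A 0 0 = 0 -> m 0 * A1 0 0 = 0 -> m 0 * A2 0 0 = 0 -> 0 <= B ->
  (forall p q, 0 < rad p q -> Rabs (m (rad p q) * A p q) <= B * rad p q ^ 2 /\
     Rabs (m' (rad p q) * A p q) <= B * rad p q /\
     Rabs (m (rad p q) * A1 p q) <= B * rad p q /\
     Rabs (m (rad p q) * A2 p q) <= B * rad p q) ->
  C1 (fun p q => m (rad p q) * A p q)
     (fun p q => m' (rad p q) * p / rad p q * A p q + m (rad p q) * A1 p q)
     (fun p q => m' (rad p q) * q / rad p q * A p q + m (rad p q) * A2 p q).
Proof.
intros HA Hm Hm' Z0 Z1 Z2 HB Hbd p q.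
destruct (Req_dec (rad p q) 0) as [H0|H0].
- destruct (rad_eq_0 p q H0) as [-> ->]; clear H0.
  assert (near : forall F : R -> R -> R, F 0 0 = 0 ->
    (forall u v, 0 < rad u v -> Rabs (F u v) <= 2 * B * rad u v) ->
    continuity_2d_pt F 0 0).
  { intros F F0 HF eps.
    (* [rad] is at most twice the maximum norm and the bound carries a factor [2 * B], hence
       [4 * B]; the 1 keeps the denominator positive. *)
    assert (Hd : 0 < eps / (4 * B + 1))
      by (apply Rdiv_lt_0_compat; [apply cond_pos|lra]).
    exists (mkposreal _ Hd); simpl; intros u v; rewrite !Rminus_0_r, F0, Rminus_0_r.
    intros Hu Hv.
    assert (M : Rmax (Rabs u) (Rabs v) < eps / (4 * B + 1)) by now apply Rmax_lub_lt.
    destruct (rad_pos u v) as [Hr|Hr].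
    - apply Rle_lt_trans with (1 := HF u v Hr).
      apply Rle_lt_trans with (2 * B * (2 * (eps / (4 * B + 1)))).
      + apply Rmult_le_compat_l; [lra|].
        generalize (rad_le u v); lra.
      + replace (2 * B * (2 * (eps / (4 * B + 1)))) with
          (eps - eps / (4 * B + 1)) by (field; lra); lra.
    - destruct (rad_eq_0 u v (eq_sym Hr)) as [-> ->].
      rewrite F0, Rabs_R0; apply cond_pos. }
  assert (ratio : forall u v w, 0 < rad u v -> Rabs w <= rad u v ->
    Rabs (m' (rad u v) * w / rad u v * A u v) <= B * rad u v).
  { intros u v w Hr Hw.
    replace (m' (rad u v) * w / rad u v * A u v)
      with (m' (rad u v) * A u v * (w / rad u v)) by (field; lra).
    rewrite Rabs_mult.
    destruct (Hbd u v Hr) as [_ [K _]].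
    rewrite <- (Rmult_1_r (B * rad u v)).
    apply Rmult_le_compat; try apply Rabs_pos; auto.
    unfold Rdiv; rewrite Rabs_mult, Rabs_inv, (Rabs_pos_eq (rad u v)) by lra.
    apply Rmult_le_reg_r with (rad u v); [lra|].
    rewrite Rmult_assoc, Rinv_l; lra. }
  repeat split.
  + replace (m' (rad 0 0) * 0 / rad 0 0 * A 0 0 + m (rad 0 0) * A1 0 0) with 0
      by (rewrite rad_0, Z1; unfold Rdiv; ring).
    replace (m' (rad 0 0) * 0 / rad 0 0 * A 0 0 + m (rad 0 0) * A2 0 0) with 0
      by (rewrite rad_0, Z2; unfold Rdiv; ring).
    intros eps.
    assert (Hd : 0 < eps / (4 * B + 1))
      by (apply Rdiv_lt_0_compat; [apply cond_pos|lra]).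
    exists (mkposreal _ Hd); simpl; intros u v; rewrite !Rminus_0_r, rad_0, Z0.
    intros Hu Hv.
    replace (m (rad u v) * A u v - 0 - (0 * u + 0 * v)) with (m (rad u v) * A u v)
      by ring.
    assert (M : Rmax (Rabs u) (Rabs v) < eps / (4 * B + 1)) by now apply Rmax_lub_lt.
    assert (M0 : 0 <= Rmax (Rabs u) (Rabs v))
      by (apply Rle_trans with (2 := Rmax_l _ _), Rabs_pos).
    destruct (rad_pos u v) as [Hr|Hr].
    * destruct (Hbd u v Hr) as [K _]; apply Rle_trans with (1 := K).
      assert (r2 := rad_le u v).
      set (w := Rmax (Rabs u) (Rabs v)) in *.
      assert (r3 : rad u v ^ 2 <= 4 * w ^ 2) by nra.
      assert (r4 := Rmult_le_compat_l B _ _ HB r3).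
      apply Rle_trans with ((4 * B + 1) * w * w); [nra|].
      apply Rmult_le_compat_r; [exact M0|].
      apply Rmult_le_reg_r with (/ (4 * B + 1)); [apply Rinv_0_lt_compat; lra|].
      replace ((4 * B + 1) * w * / (4 * B + 1)) with w by (field; lra).
      unfold Rdiv in M; lra.
    * destruct (rad_eq_0 u v (eq_sym Hr)) as [-> ->].
      rewrite rad_0, Z0, Rabs_R0, Rmax_left; lra.
  + apply near; [rewrite rad_0, Z1; unfold Rdiv; ring|].
    intros u v Hr; destruct (Hbd u v Hr) as [_ [_ [K _]]].
    apply Rle_trans with (1 := Rabs_triang _ _).
    generalize (ratio u v u Hr (proj1 (rad_bounds u v))); lra.
  + apply near; [rewrite rad_0, Z2; unfold Rdiv; ring|].
    intros u v Hr; destruct (Hbd u v Hr) as [_ [_ [_ K]]].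
    apply Rle_trans with (1 := Rabs_triang _ _).
    generalize (ratio u v v Hr (proj2 (rad_bounds u v))); lra.
- assert (Hr : 0 < rad p q) by (generalize (rad_pos p q); lra).
  assert (cm : continuity_2d_pt (fun u v => m (rad u v)) p q).
  { apply continuity_1d_2d_pt_comp; [|apply rad_continuity].
    apply continuity_pt_filterlim; unfold rad; apply (@ex_derive_continuous R_AbsRing R_NormedModule).
    exists (m' (rad p q)); now apply Hm. }
  assert (cm' : continuity_2d_pt (fun u v => m' (rad u v)) p q).
  { apply continuity_1d_2d_pt_comp; [|apply rad_continuity].
    now apply continuity_pt_filterlim, Hm'. }
  assert (cA : continuity_2d_pt A p q) by (eapply C1_continuity; eassumption).
  assert (ci : continuity_2d_pt (fun u v => / rad u v) p q)
    by (apply continuity_2d_pt_inv; [apply rad_continuity|exact H0]).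
  repeat split.
  + apply radial_mult_differentiable; auto.
  + unfold Rdiv; apply continuity_2d_pt_plus; repeat apply continuity_2d_pt_mult;
      auto; try apply continuity_2d_pt_id1; apply HA.
  + unfold Rdiv; apply continuity_2d_pt_plus; repeat apply continuity_2d_pt_mult;
      auto; try apply continuity_2d_pt_id2; apply HA.
Qed.

(** * The stress field and the test field *)

(* At [t = 0] these have junk values, which only occur multiplied by 0. *)
Definition ratio (g1 : R -> R) (t : R) : R := g1 t / t.
Definition ratio' (g1 g2 : R -> R) (t : R) : R := (g2 t - g1 t / t) / t.

(** This is Y. Its last summand is bounded, quadratic at 0, and has derivative 2 t / (1 + t)^3.
    Accordingly [slope] is Y' / t, and [weight] is the radial factor of the test field. *)
Definition excess (g g1 : R -> R) (t : R) : R :=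
  t * g1 t - g t + g 0 + (t / (1 + t)) ^ 2.
Definition slope (g2 : R -> R) (t : R) : R := g2 t + 2 / (1 + t) ^ 3.
Definition weight (g g1 : R -> R) (t : R) : R := (excess g g1 t / t) ^ 2.
Definition weight' (g g1 g2 : R -> R) (t : R) : R :=
  2 * (excess g g1 t / t) * (slope g2 t - excess g g1 t / t ^ 2).

(** The quadratic bound gives smoothness of the test field at critical points and, with boundedness,
    decay relative to [t ^ 2] at infinity. The last bound uses [g 0 <= g t] for the Legendre part
    and [ed_g1_lower] for the rational one. *)
Lemma excess_bounds (g g1 g2 : R -> R) (c0 c L t : R) :
  energy_density g g1 g2 c0 c L -> 0 < t ->
  0 < excess g g1 t /\ excess g g1 t <= L + 1 /\
  excess g g1 t <= (c + 1) * t ^ 2 /\ excess g g1 t <= (1 + / c0) * (t * g1 t).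
Proof.
intros E Ht; unfold excess.
assert (Hc0 := ed_c0 _ _ _ _ _ _ E).
assert (r1 : 0 < t / (1 + t)) by (apply Rdiv_lt_0_compat; lra).
assert (r2 : t / (1 + t) < 1).
{ apply Rmult_lt_reg_r with (1 + t); [lra|].
  unfold Rdiv; rewrite Rmult_assoc, Rinv_l; lra. }
assert (r3 : t / (1 + t) <= t).
{ apply Rmult_le_reg_r with (1 + t); [lra|].
  unfold Rdiv; rewrite Rmult_assoc, Rinv_l; nra. }
assert (r4 : t * (t / (1 + t)) <= / c0 * (t * g1 t)).
{ replace (/ c0 * (t * g1 t)) with (t * (g1 t * / c0)) by ring.
  apply Rmult_le_compat_l; [lra|].
  apply Rmult_le_reg_r with (c0 * (1 + t)); [nra|].
  replace (t / (1 + t) * (c0 * (1 + t))) with (c0 * t) by (field; lra).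
  replace (g1 t * / c0 * (c0 * (1 + t))) with (g1 t * (1 + t)) by (field; lra).
  apply (ed_g1_lower _ _ _ _ _ _ E t Ht). }
generalize (ed_g_ge _ _ _ _ _ _ E t Ht) (ed_g_le _ _ _ _ _ _ E t Ht)
  (ed_legendre _ _ _ _ _ _ E t Ht) (ed_g1_upper _ _ _ _ _ _ E t Ht).
intros; repeat split; nra.
Qed.

Lemma is_derive_excess (g g1 g2 : R -> R) (c0 c L t : R) :
  energy_density g g1 g2 c0 c L -> 0 < t ->
  is_derive (excess g g1) t (t * slope g2 t).
Proof.
intros E Ht; unfold excess.
assert (D0 := ed_g1 _ _ _ _ _ _ E t Ht); assert (D1 := ed_g2 _ _ _ _ _ _ E t Ht).
auto_derive.
- repeat split; [now exists (g2 t)|now exists (g1 t)|lra].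
- rewrite (is_derive_unique (fun x : R => g1 x) _ _ D1).
  rewrite (is_derive_unique (fun x : R => g x) _ _ D0); unfold slope; field; lra.
Qed.

Lemma is_derive_weight (g g1 g2 : R -> R) (c0 c L t : R) :
  energy_density g g1 g2 c0 c L -> 0 < t ->
  is_derive (weight g g1) t (weight' g g1 g2 t).
Proof.
intros E Ht; unfold weight.
assert (D := is_derive_excess _ _ _ _ _ _ t E Ht).
auto_derive.
- repeat split; [now exists (t * slope g2 t)|lra].
- rewrite (is_derive_unique (fun x : R => excess g g1 x) _ _ D); unfold weight'; field; lra.
Qed.

Lemma is_derive_ratio (g g1 g2 : R -> R) (c0 c L t : R) :
  energy_density g g1 g2 c0 c L -> 0 < t ->
  is_derive (ratio g1) t (ratio' g1 g2 t).
Proof.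
intros E Ht; unfold ratio.
assert (D1 := ed_g2 _ _ _ _ _ _ E t Ht).
auto_derive.
- repeat split; [now exists (g2 t)|lra].
- rewrite (is_derive_unique (fun x : R => g1 x) _ _ D1); unfold ratio'; field; lra.
Qed.

(** The two lower bounds serve different Hessian entries in [key_estimate]: the first cancels a
    factor g'', the second replaces a lower bound on g''. *)
Lemma slope_bounds (g g1 g2 : R -> R) (c0 c L t : R) :
  energy_density g g1 g2 c0 c L -> 0 < t ->
  g2 t <= slope g2 t /\ slope g2 t <= c + 2 /\ 2 <= slope g2 t * (1 + t) ^ 3.
Proof.
intros E Ht; unfold slope.
destruct (ed_g2_pos _ _ _ _ _ _ E t Ht).
assert (P : 1 <= (1 + t) ^ 3) by (apply pow_R1_Rle; lra).
assert (0 < 2 / (1 + t) ^ 3) by (apply Rdiv_lt_0_compat; lra).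
assert (2 / (1 + t) ^ 3 * (1 + t) ^ 3 = 2) by (field; lra).
repeat split; nra.
Qed.

(** With z = Y / t, the quadratic bound on Y for t <= 1 and boundedness for t > 1 give z <= c + 1 +
    L + 1; the difference of [slope] and Y / t^2 is at most 2 c + 3 in absolute value. [B] adds the
    two resulting constants. *)
Lemma weight_bounds (g g1 g2 : R -> R) (c0 c L t : R) :
  energy_density g g1 g2 c0 c L -> 0 < t ->
  let B := (c + 1 + L + 1) ^ 2 + 2 * (c + 1 + L + 1) * (2 * c + 3) in
  0 <= weight g g1 t <= B * t /\ Rabs (weight' g g1 g2 t) <= B.
Proof.
intros E Ht B.
destruct (excess_bounds _ _ _ _ _ _ t E Ht) as [y0 [y1 [y2 _]]].
destruct (slope_bounds _ _ _ _ _ _ t E Ht) as [s0 [s1 _]].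
assert (Hg := ed_g2_pos _ _ _ _ _ _ E t Ht).
assert (Hc := ed_c _ _ _ _ _ _ E); assert (HL := ed_L _ _ _ _ _ _ E).
unfold weight, weight'; set (y := excess g g1 t) in *.
assert (z0 : 0 < y / t) by (apply Rdiv_lt_0_compat; lra).
assert (Ey : y / t * t = y) by (field; lra).
assert (z1 : y / t <= (c + 1) * t).
{ apply Rmult_le_reg_r with t; lra. }
assert (z2 : y / t <= c + 1 + L + 1).
{ destruct (Rle_or_lt t 1); [nra|].
  apply Rmult_le_reg_r with t; [lra|]; nra. }
assert (w0 : 0 <= y / t ^ 2 <= c + 1).
{ assert (0 < t ^ 2) by (apply pow_lt; lra); split.
  - apply Rlt_le, Rdiv_lt_0_compat; lra.
  - apply Rmult_le_reg_r with (t ^ 2); [lra|].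
    replace (y / t ^ 2 * t ^ 2) with y by (field; lra); lra. }
set (z := y / t) in *; set (w := y / t ^ 2) in *; set (s := slope g2 t) in *.
repeat split.
- apply pow2_ge_0.
- unfold B; assert (z ^ 2 <= (c + 1 + L + 1) * ((c + 1) * t)) by nra.
  assert (0 <= (c + 1 + L + 1) * (L + 1) * t) by (repeat apply Rmult_le_pos; lra).
  assert (0 <= 2 * (c + 1 + L + 1) * (2 * c + 3) * t)
    by (repeat apply Rmult_le_pos; lra).
  nra.
- rewrite !Rabs_mult, (Rabs_pos_eq 2), (Rabs_pos_eq z) by lra.
  assert (Rabs (s - w) <= 2 * c + 3) by (apply Rabs_le_between; lra).
  assert (2 * z * Rabs (s - w) <= 2 * (c + 1 + L + 1) * (2 * c + 3)).
  { apply Rmult_le_compat; try apply Rabs_pos; lra. }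
  unfold B; generalize (pow2_ge_0 (c + 1 + L + 1)); lra.
Qed.

(** J is a multiple of the identity minus [ratio g1] times n n^T with n = (-q, p). Up to the
    constant it is the cofactor matrix of the energy-momentum tensor, so that divergence-free rows
    become curl-free ones. The constant [1 + L] lifts the smaller eigenvalue to at least 1. *)
Definition J11 (g g1 : R -> R) (L p q : R) : R :=
  1 + L + (g (rad p q) - g 0) - ratio g1 (rad p q) * q ^ 2.
Definition J12 (g1 : R -> R) (p q : R) : R := ratio g1 (rad p q) * (p * q).
Definition J22 (g g1 : R -> R) (L p q : R) : R :=
  1 + L + (g (rad p q) - g 0) - ratio g1 (rad p q) * p ^ 2.

(** One statement covers all entries of J and of the test field. For exponent 0 the truncated [pred]
    is harmless because of the factor [INR 0]. *)
Lemma C1_monomial (i j : nat) :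
  C1 (fun p q => p ^ i * q ^ j) (fun p q => INR i * p ^ pred i * q ^ j)
     (fun p q => p ^ i * (INR j * q ^ pred j)).
Proof.
assert (cp : forall n x, continuous (fun s => s ^ n) x).
{ intros n x; apply (@ex_derive_continuous R_AbsRing R_NormedModule); auto_derive; auto. }
assert (c1 : forall n x y, continuity_2d_pt (fun u _ => u ^ n) x y).
{ intros n x y; apply (continuity_1d_2d_pt_comp (fun s => s ^ n) (fun u _ => u)).
  - apply continuity_pt_filterlim, cp.
  - apply continuity_2d_pt_id1. }
assert (c2 : forall n x y, continuity_2d_pt (fun _ v => v ^ n) x y).
{ intros n x y; apply (continuity_1d_2d_pt_comp (fun s => s ^ n) (fun _ v => v)).
  - apply continuity_pt_filterlim, cp.
  - apply continuity_2d_pt_id2. }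
apply C1_of_partials; intros x y.
- auto_derive; auto; ring.
- auto_derive; auto; ring.
- repeat apply continuity_2d_pt_mult; try apply continuity_2d_pt_const; auto.
- repeat apply continuity_2d_pt_mult; try apply continuity_2d_pt_const; auto.
Qed.

Lemma continuous_inv_pos (t : R) : 0 < t -> continuous (fun s => / s) t.
Proof. intros; apply continuous_Rinv; lra. Qed.

Lemma C1_energy (g g1 g2 : R -> R) (c0 c L : R) :
  energy_density g g1 g2 c0 c L ->
  C1 (fun p q => g (rad p q) - g 0)
     (fun p q => g1 (rad p q) * p / rad p q)
     (fun p q => g1 (rad p q) * q / rad p q).
Proof.
intros E; assert (Hc := ed_c _ _ _ _ _ _ E).
assert (H := radial_C1 (fun t => g t - g 0) g1 (fun _ _ => 1)
  (fun _ _ => 0) (fun _ _ => 0) c (C1_const 1)).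
eapply C1_ext; [| | |apply H]; try (intros; simpl; ring); try lra.
- intros t Ht; rewrite <- (Rminus_0_r (g1 t)).
  apply (is_derive_minus g (fun _ => g 0)); [apply (ed_g1 _ _ _ _ _ _ E t Ht)|].
  apply @is_derive_const.
- intros t Ht; apply (@ex_derive_continuous R_AbsRing R_NormedModule).
  exists (g2 t); apply (ed_g2 _ _ _ _ _ _ E t Ht).
- intros p q Hr; set (t := rad p q) in *.
  generalize (ed_g_ge _ _ _ _ _ _ E t Hr) (ed_g_le _ _ _ _ _ _ E t Hr)
    (ed_g1_upper _ _ _ _ _ _ E t Hr) (ed_g1_lower _ _ _ _ _ _ E t Hr)
    (ed_c0 _ _ _ _ _ _ E); intros.
  assert (0 <= g1 t).
  { apply Rmult_le_reg_r with (1 + t); [lra|]; nra. }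
  rewrite !Rmult_1_r, !Rmult_0_r, Rabs_R0, !Rabs_pos_eq by lra.
  repeat split; nra.
Qed.

(** Both g'' and g' / t lie between 0 and c, so [ratio] is bounded by c and [ratio'] by c / t; a
    quadratic factor then meets the requirements of [radial_C1]. *)
Lemma C1_ratio_quadratic (g g1 g2 : R -> R) (c0 c L : R) (i j : nat) :
  energy_density g g1 g2 c0 c L -> (i + j = 2)%nat ->
  C1 (fun p q => ratio g1 (rad p q) * (p ^ i * q ^ j))
     (fun p q => ratio' g1 g2 (rad p q) * p / rad p q * (p ^ i * q ^ j) +
        ratio g1 (rad p q) * (INR i * p ^ pred i * q ^ j))
     (fun p q => ratio' g1 g2 (rad p q) * q / rad p q * (p ^ i * q ^ j) +
        ratio g1 (rad p q) * (p ^ i * (INR j * q ^ pred j))).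
Proof.
intros E Hij; assert (Hc := ed_c _ _ _ _ _ _ E).
assert (cases : (i = 0 /\ j = 2 \/ i = 1 /\ j = 1 \/ i = 2 /\ j = 0)%nat) by lia.
apply radial_C1 with (2 * c); try lra.
- apply C1_monomial.
- intros t; apply (is_derive_ratio _ _ _ _ _ _ t E).
- intros t Ht; unfold ratio'.
  assert (ci := continuous_inv_pos t Ht).
  apply (continuous_mult (fun s => g2 s - g1 s / s) (fun s => / s)); [|exact ci].
  apply (continuous_minus g2 (fun s => g1 s / s)).
  + apply (ed_cont _ _ _ _ _ _ E t Ht).
  + apply (continuous_mult g1 (fun s => / s)); [|exact ci].
    apply (@ex_derive_continuous R_AbsRing R_NormedModule).
    exists (g2 t); apply (ed_g2 _ _ _ _ _ _ E t Ht).
- destruct cases as [[-> ->]|[[-> ->]|[-> ->]]]; simpl; ring.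
- destruct cases as [[-> ->]|[[-> ->]|[-> ->]]]; simpl; ring.
- destruct cases as [[-> ->]|[[-> ->]|[-> ->]]]; simpl; ring.
- intros p q Hr; destruct (rad_bounds p q) as [bp bq]; set (t := rad p q) in *.
  generalize (ed_g1_upper _ _ _ _ _ _ E t Hr) (ed_g1_lower _ _ _ _ _ _ E t Hr)
    (ed_c0 _ _ _ _ _ _ E) (ed_g2_pos _ _ _ _ _ _ E t Hr); intros.
  assert (g1p : 0 <= g1 t).
  { apply Rmult_le_reg_r with (1 + t); [lra|]; nra. }
  assert (it : 0 < / t) by now apply Rinv_0_lt_compat.
  assert (rt : 0 <= ratio g1 t <= c).
  { unfold ratio, Rdiv; split; [apply Rmult_le_pos; lra|].
    apply Rmult_le_reg_r with t; [lra|]; rewrite Rmult_assoc, Rinv_l; lra. }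
  assert (rt' : Rabs (ratio' g1 g2 t) <= c * / t).
  { unfold ratio'; fold (ratio g1 t); unfold Rdiv; rewrite Rabs_mult.
    rewrite (Rabs_pos_eq (/ t)) by lra; apply Rmult_le_compat_r; [lra|].
    apply Rabs_le_between; lra. }
  assert (quad : Rabs (p ^ i * q ^ j) <= t ^ 2).
  { rewrite Rabs_mult, <- !RPow_abs, <- Hij, pow_add.
    apply Rmult_le_compat; try (apply pow_le, Rabs_pos);
      apply pow_incr; split; auto using Rabs_pos. }
  assert (lin : Rabs (INR i * p ^ pred i * q ^ j) <= 2 * t /\
                Rabs (p ^ i * (INR j * q ^ pred j)) <= 2 * t).
  { destruct cases as [[-> ->]|[[-> ->]|[-> ->]]]; simpl;
      rewrite ?Rmult_0_l, ?Rmult_0_r, ?Rmult_1_l, ?Rmult_1_r, ?Rabs_mult, ?Rabs_R0,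
        ?(Rabs_pos_eq (1 + 1)); lra. }
  rewrite !(Rabs_mult (ratio _ _)), (Rabs_mult (ratio' _ _ _)).
  rewrite (Rabs_pos_eq (ratio g1 t)) by lra.
  repeat split.
  + apply Rle_trans with (c * t ^ 2); [|generalize (pow2_ge_0 t); nra].
    apply Rmult_le_compat; try apply Rabs_pos; lra.
  + apply Rle_trans with (c * / t * t ^ 2).
    * apply Rmult_le_compat; try apply Rabs_pos; lra.
    * replace (c * / t * t ^ 2) with (c * t) by (field; lra); nra.
  + replace (2 * c * t) with (c * (2 * t)) by ring.
    apply Rmult_le_compat; try apply Rabs_pos; lra.
  + replace (2 * c * t) with (c * (2 * t)) by ring.
    apply Rmult_le_compat; try apply Rabs_pos; lra.
Qed.

Lemma C1_weight_linear (g g1 g2 : R -> R) (c0 c L : R) (i j : nat) :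
  energy_density g g1 g2 c0 c L -> (i + j = 1)%nat ->
  C1 (fun p q => weight g g1 (rad p q) * (p ^ i * q ^ j))
     (fun p q => weight' g g1 g2 (rad p q) * p / rad p q * (p ^ i * q ^ j) +
        weight g g1 (rad p q) * (INR i * p ^ pred i * q ^ j))
     (fun p q => weight' g g1 g2 (rad p q) * q / rad p q * (p ^ i * q ^ j) +
        weight g g1 (rad p q) * (p ^ i * (INR j * q ^ pred j))).
Proof.
intros E Hij; assert (Hc := ed_c _ _ _ _ _ _ E); assert (HL := ed_L _ _ _ _ _ _ E).
assert (cases : (i = 0 /\ j = 1 \/ i = 1 /\ j = 0)%nat) by lia.
assert (W0 : weight g g1 0 = 0) by (unfold weight, excess, Rdiv; ring).
set (B := (c + 1 + L + 1) ^ 2 + 2 * (c + 1 + L + 1) * (2 * c + 3)).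
assert (HB : 0 <= B).
{ unfold B; apply Rplus_le_le_0_compat; [apply pow2_ge_0|].
  repeat apply Rmult_le_pos; lra. }
apply radial_C1 with B; try (rewrite W0; ring); try exact HB.
- apply C1_monomial.
- intros t; apply (is_derive_weight _ _ _ _ _ _ t E).
- intros t Ht; unfold weight'.
  assert (ci := continuous_inv_pos t Ht).
  assert (ce : continuous (excess g g1) t).
  { apply (@ex_derive_continuous R_AbsRing R_NormedModule).
    exists (t * slope g2 t); apply (is_derive_excess _ _ _ _ _ _ t E Ht). }
  apply (continuous_mult (fun s => 2 * (excess g g1 s / s))
           (fun s => slope g2 s - excess g g1 s / s ^ 2)).
  + apply (continuous_scal_r 2 (fun s => excess g g1 s / s)).
    now apply (continuous_mult (excess g g1) (fun s => / s)).
  + apply (continuous_minus (slope g2) (fun s => excess g g1 s / s ^ 2)).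
    * apply (continuous_plus g2 (fun s => 2 / (1 + s) ^ 3)).
      -- apply (ed_cont _ _ _ _ _ _ E t Ht).
      -- apply (@ex_derive_continuous R_AbsRing R_NormedModule); auto_derive.
         apply Rgt_not_eq; repeat apply Rmult_lt_0_compat; lra.
    * apply (continuous_mult (excess g g1) (fun s => / s ^ 2)); [exact ce|].
      apply (@ex_derive_continuous R_AbsRing R_NormedModule); auto_derive.
      nra.
- intros p q Hr; destruct (rad_bounds p q) as [bp bq]; set (t := rad p q) in *.
  destruct (weight_bounds _ _ _ _ _ _ t E Hr) as [[w0 w1] w2]; fold B in w1, w2.
  assert (lin : Rabs (p ^ i * q ^ j) <= t).
  { destruct cases as [[-> ->]|[-> ->]]; simpl; rewrite ?Rmult_1_l, ?Rmult_1_r; auto. }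
  assert (cst : Rabs (INR i * p ^ pred i * q ^ j) <= 1 /\
                Rabs (p ^ i * (INR j * q ^ pred j)) <= 1).
  { destruct cases as [[-> ->]|[-> ->]]; simpl;
      rewrite ?Rmult_0_l, ?Rmult_0_r, ?Rmult_1_l, ?Rmult_1_r, ?Rabs_R0, ?Rabs_R1; lra. }
  rewrite !(Rabs_mult (weight _ _ _)), (Rabs_mult (weight' _ _ _ _)).
  rewrite (Rabs_pos_eq (weight g g1 t)) by lra.
  repeat split.
  + replace (B * t ^ 2) with (B * t * t) by ring.
    apply Rmult_le_compat; try apply Rabs_pos; lra.
  + apply Rmult_le_compat; try apply Rabs_pos; lra.
  + rewrite <- (Rmult_1_r (B * t)); apply Rmult_le_compat; try apply Rabs_pos; lra.
  + rewrite <- (Rmult_1_r (B * t)); apply Rmult_le_compat; try apply Rabs_pos; lra.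
Qed.

Lemma ratio_bounds (g g1 g2 : R -> R) (c0 c L t : R) :
  energy_density g g1 g2 c0 c L -> 0 < t -> 0 < ratio g1 t <= c.
Proof.
intros E Ht; unfold ratio.
generalize (ed_g1_upper _ _ _ _ _ _ E t Ht) (ed_g1_lower _ _ _ _ _ _ E t Ht)
  (ed_c0 _ _ _ _ _ _ E); intros.
assert (0 < g1 t) by (apply Rmult_lt_reg_r with (1 + t); nra).
split; [apply Rdiv_lt_0_compat; lra|].
apply Rmult_le_reg_r with t; [lra|].
unfold Rdiv; rewrite Rmult_assoc, Rinv_l; lra.
Qed.

(* [1 + L + (g t - g 0)] and the same minus [t * g1 t] are the eigenvalues of J,
   along and across the gradient. *)
Lemma eigenvalue_bounds (g g1 g2 : R -> R) (c0 c L : R) :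
  energy_density g g1 g2 c0 c L ->
  exists K, 0 < K /\ forall t, 0 < t ->
    let lam := 1 + L + (g t - g 0) in
    let mu := lam - t * g1 t in
    1 <= mu /\
    excess g g1 t ^ 3 * lam <= 2 * K * (t * g1 t) /\
    excess g g1 t ^ 3 * mu * (1 + t) ^ 3 <= 4 * K * t ^ 2 * lam.
Proof.
intros E.
assert (Hc0 := ed_c0 _ _ _ _ _ _ E); assert (Hc := ed_c _ _ _ _ _ _ E).
assert (HL := ed_L _ _ _ _ _ _ E).
set (D := L + 1).
(* Chosen so that [lam >= k * (1 + t)]: [lam] is at least 1 + t g', t g' (1 + t) is at least c0 t^2,
   and (1 + t)^2 <= 2 + 2 t^2. *)
set (k := Rmin 1 c0 / 2).
assert (Hk : 0 < k /\ k <= 1 / 2 /\ k <= c0 / 2).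
{ unfold k; generalize (Rmin_pos 1 c0 Rlt_0_1 Hc0) (Rmin_l 1 c0) (Rmin_r 1 c0); lra. }
assert (HD : 1 <= D) by (unfold D; lra).
assert (D3 : 1 <= D ^ 3) by (now apply pow_R1_Rle).
assert (ic0 : 0 < / c0) by now apply Rinv_0_lt_compat.
assert (ik : 0 < / k) by now apply Rinv_0_lt_compat.
(* Write lam = mu + w with w = t g'. Both Y and mu are at most [D]; one spare factor Y is bounded by
   (1 + / c0) w for [K1], and by a multiple of t^2 / (1 + t)^2 for [K2]. *)
set (K1 := D ^ 3 * (2 + / c0)).
set (K2 := D ^ 3 * (c + 1 + D) * / k).
assert (HK1 : 0 < K1) by (unfold K1; apply Rmult_lt_0_compat; clearbody D; lra).
assert (HK2 : 0 < K2) by (unfold K2; repeat apply Rmult_lt_0_compat; lra).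
exists (K1 + K2); split; [lra|]; intros t Ht lam mu.
destruct (excess_bounds _ _ _ _ _ _ t E Ht) as [y0 [y1 [y2 y3]]].
generalize (ed_g_ge _ _ _ _ _ _ E t Ht) (ed_g_le _ _ _ _ _ _ E t Ht)
  (ed_legendre _ _ _ _ _ _ E t Ht) (ed_g1_lower _ _ _ _ _ _ E t Ht).
intros G1 G2 G3 G4.
set (y := excess g g1 t) in *; set (w := t * g1 t) in *.
assert (mu1 : 1 <= mu <= D) by (unfold mu, lam, D; lra).
assert (lw : lam = mu + w) by (unfold mu; ring).
assert (w0 : 0 < w).
{ unfold w; apply Rmult_lt_0_compat; [lra|].
  apply Rmult_lt_reg_r with (1 + t); nra. }
assert (lk : k * (1 + t) <= lam).
{ apply Rmult_le_reg_r with (1 + t); [lra|].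
  apply Rle_trans with ((1 + w) * (1 + t)); [|apply Rmult_le_compat_r; lra].
  assert (c0 * t ^ 2 <= w * (1 + t)) by (unfold w; nra).
  assert (k * (1 + t) ^ 2 <= k * 2 + k * (2 * t ^ 2)).
  { generalize (Rmult_le_pos k _ ltac:(lra) (pow2_ge_0 (1 - t))); lra. }
  assert (k * (2 * t ^ 2) <= c0 * t ^ 2) by (generalize (pow2_ge_0 t); nra).
  nra. }
assert (ysq : 0 < y ^ 2 <= D ^ 2).
{ split; [apply pow_lt; lra|apply pow_incr; unfold D; lra]. }
repeat split; [lra| |].
- assert (y ^ 3 * lam <= 2 * K1 * w).
  { assert (A1 : y ^ 3 * mu <= D ^ 3 * ((1 + / c0) * w)).
    { replace (y ^ 3 * mu) with (y ^ 2 * mu * y) by ring.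
      replace (D ^ 3) with (D ^ 2 * D) by ring.
      apply Rmult_le_compat; try lra; [apply Rmult_le_pos; lra|].
      apply Rmult_le_compat; lra. }
    assert (A2 : y ^ 3 * w <= D ^ 3 * w).
    { apply Rmult_le_compat_r; [lra|]; apply pow_incr; unfold D; lra. }
    assert (0 < K1 * w) by now apply Rmult_lt_0_compat.
    unfold K1 in *; rewrite lw; lra. }
  assert (0 < K2 * w) by now apply Rmult_lt_0_compat.
  lra.
- assert (yt : y * (1 + t) ^ 2 <= 2 * (c + 1 + D) * t ^ 2).
  { assert (y * t ^ 2 <= D * t ^ 2) by (apply Rmult_le_compat_r; [apply pow2_ge_0|unfold D; lra]).
    generalize (Rmult_le_pos y _ ltac:(lra) (pow2_ge_0 (1 - t))); lra. }
  assert (lt' : 1 + t <= / k * lam).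
  { apply Rmult_le_reg_l with k; [lra|].
    rewrite <- Rmult_assoc, Rinv_r; lra. }
  assert (A : y ^ 3 * mu * (1 + t) ^ 3 <= D ^ 3 * (2 * (c + 1 + D) * t ^ 2) * (/ k * lam)).
  { replace (y ^ 3 * mu * (1 + t) ^ 3) with (y ^ 2 * mu * (y * (1 + t) ^ 2) * (1 + t))
      by ring.
    assert (0 <= (1 + t) ^ 2) by apply pow2_ge_0.
    apply Rmult_le_compat; try lra.
    - repeat apply Rmult_le_pos; lra.
    - apply Rmult_le_compat; try lra.
      + apply Rmult_le_pos; lra.
      + apply Rmult_le_pos; lra.
      + replace (D ^ 3) with (D ^ 2 * D) by ring; apply Rmult_le_compat; lra. }
  assert (0 < t ^ 2 * lam).
  { apply Rmult_lt_0_compat; [apply pow_lt|]; lra. }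
  assert (0 < K1 * (t ^ 2 * lam)) by (apply Rmult_lt_0_compat; lra).
  assert (0 < K2 * (t ^ 2 * lam)) by (apply Rmult_lt_0_compat; lra).
  replace (D ^ 3 * (2 * (c + 1 + D) * t ^ 2) * (/ k * lam)) with (2 * (K2 * (t ^ 2 * lam)))
    in A by (unfold K2; ring).
  lra.
Qed.

(** * Cut-off functions *)

Definition pos (s : R) : R := Rmax 0 s.

Lemma pos_ge_0 (s : R) : 0 <= pos s.
Proof. apply Rmax_l. Qed.

Lemma pos_Rabs (t : R) : pos t = (t + Rabs t) * / 2.
Proof.
unfold pos; destruct (Rle_or_lt 0 t) as [h|h].
- rewrite Rmax_right, Rabs_pos_eq by lra; field.
- rewrite Rmax_left, Rabs_left by lra; field.
Qed.

Lemma continuous_pos (s : R) : continuous pos s.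
Proof.
apply continuous_ext with (fun t => (t + Rabs t) * / 2).
- intros t; now rewrite pos_Rabs.
- apply (continuous_mult (fun t => t + Rabs t) (fun _ => / 2));
    [|apply continuous_const].
  apply (continuous_plus (fun t => t) Rabs);
    [apply continuous_id|apply continuous_Rabs].
Qed.

Lemma is_derive_pos2 (s : R) : is_derive (fun t => pos t ^ 2) s (2 * pos s).
Proof.
unfold pos; destruct (Rtotal_order s 0) as [h|[->|h]].
- rewrite Rmax_left by lra; rewrite Rmult_0_r.
  apply is_derive_ext_loc with (fun _ => 0).
  + assert (hp : 0 < - s) by lra.
    exists (mkposreal _ hp); intros y Hy; apply Rabs_lt_between in Hy.
    unfold minus, plus, opp in Hy; simpl in Hy.
    rewrite Rmax_left by lra; symmetry; apply pow_ne_zero; discriminate.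
  + apply @is_derive_const.
- rewrite Rmax_left by lra; rewrite Rmult_0_r.
  apply is_derive_Reals; intros e He; exists (mkposreal e He); intros x Hx Hx'.
  simpl in Hx'.
  rewrite Rplus_0_l, (Rmax_left 0 0), Rminus_0_r by lra.
  destruct (Rle_or_lt x 0) as [h|h].
  + rewrite Rmax_left by lra.
    replace ((0 ^ 2 - 0 ^ 2) / x) with 0 by (field; exact Hx).
    now rewrite Rabs_R0.
  + rewrite Rmax_right by lra.
    now replace ((x ^ 2 - 0 ^ 2) / x) with x by (field; exact Hx).
- rewrite Rmax_right by lra.
  apply is_derive_ext_loc with (fun t => t ^ 2).
  + exists (mkposreal _ h); intros y Hy; apply Rabs_lt_between in Hy.
    unfold minus, plus, opp in Hy; simpl in Hy.
    now rewrite Rmax_right by lra.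
  + auto_derive; auto; ring.
Qed.

Lemma is_derive_pos3 (s : R) : is_derive (fun t => pos t ^ 3) s (3 * pos s ^ 2).
Proof.
assert (E : forall t, t * pos t = pos t ^ 2).
{ intros t; unfold pos; destruct (Rle_or_lt 0 t).
  - rewrite Rmax_right by lra; ring.
  - rewrite Rmax_left by lra; ring. }
assert (E3 : forall t, t * pos t ^ 2 = pos t ^ 3).
{ intros t; transitivity (pos t * (t * pos t)); [ring|rewrite E; ring]. }
apply is_derive_ext with (fun t => t * pos t ^ 2); [exact E3|].
replace (3 * pos s ^ 2) with (plus (mult 1 (pos s ^ 2)) (mult s (2 * pos s))).
- apply (is_derive_mult (fun t => t) (fun t => pos t ^ 2));
    [apply @is_derive_id|apply is_derive_pos2|intros; apply Rmult_comm].
- unfold plus, mult; simpl; transitivity (pos s ^ 2 + 2 * (s * pos s));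
    [ring|rewrite E; ring].
Qed.

(** Only powers are used, since [pos] has a corner: the cube on the main field, the square on the
    corrector. Young's inequality applied to the derivative of the cube leaves one factor [log_cut],
    the same power that the derivative of the square contains. *)
Definition log_cut (ell r : R) : R := pos (1 - ln (1 + r) / ell).
(** The simpler 1 / (1 + r) would make r kappa(r) increase everywhere and spread the error over the
    whole support. Here r kappa(r) = (r^2 + 2 r) / (1 + r^2) dominates r / (1 + r) but decreases for
    r >= 2, so the error stays in a region independent of [ell]. *)
Definition kappa (r : R) : R := (r + 2) / (1 + r ^ 2).
Definition kappa' (r : R) : R := (1 - 4 * r - r ^ 2) / (1 + r ^ 2) ^ 2.

Lemma is_derive_log (ell r : R) : 0 < ell -> 0 <= r ->
  is_derive (fun r => 1 - ln (1 + r) / ell) r (- / (ell * (1 + r))).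
Proof. intros; auto_derive; [lra|field; lra]. Qed.

Lemma is_derive_log_cut3 (ell r : R) : 0 < ell -> 0 <= r ->
  is_derive (fun r => log_cut ell r ^ 3) r
    (- 3 * log_cut ell r ^ 2 / (ell * (1 + r))).
Proof.
intros He Hr.
replace (- 3 * log_cut ell r ^ 2 / (ell * (1 + r)))
  with (scal (- / (ell * (1 + r))) (3 * pos (1 - ln (1 + r) / ell) ^ 2))
  by (unfold scal, log_cut; simpl; unfold mult; simpl; field; lra).
apply (is_derive_comp (fun s => pos s ^ 3)); [apply is_derive_pos3|].
now apply is_derive_log.
Qed.

Lemma is_derive_log_cut2 (ell r : R) : 0 < ell -> 0 <= r ->
  is_derive (fun r => log_cut ell r ^ 2) r
    (- 2 * log_cut ell r / (ell * (1 + r))).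
Proof.
intros He Hr.
replace (- 2 * log_cut ell r / (ell * (1 + r)))
  with (scal (- / (ell * (1 + r))) (2 * pos (1 - ln (1 + r) / ell)))
  by (unfold scal, log_cut; simpl; unfold mult; simpl; field; lra).
apply (is_derive_comp (fun s => pos s ^ 2)); [apply is_derive_pos2|].
now apply is_derive_log.
Qed.

Lemma is_derive_kappa (r : R) : is_derive kappa r (kappa' r).
Proof.
unfold kappa, kappa'; assert (0 < 1 + r ^ 2) by (generalize (pow2_ge_0 r); lra).
auto_derive; [|field]; nra.
Qed.

Lemma is_derive_corrector (k ell r : R) : 0 < ell -> 0 <= r ->
  is_derive (fun r => - k * (log_cut ell r ^ 2 * kappa r)) r
   (- k * (- 2 * log_cut ell r / (ell * (1 + r)) * kappa r +
           log_cut ell r ^ 2 * kappa' r)).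
Proof.
intros He Hr; apply (is_derive_scal (fun r => log_cut ell r ^ 2 * kappa r)).
apply (is_derive_mult (fun r => log_cut ell r ^ 2) kappa).
- now apply is_derive_log_cut2.
- apply is_derive_kappa.
- intros; apply Rmult_comm.
Qed.

Lemma continuous_log_cut (ell r : R) : 0 < ell -> 0 <= r -> continuous (log_cut ell) r.
Proof.
intros He Hr; apply (continuous_comp (fun r => 1 - ln (1 + r) / ell) pos).
- apply (@ex_derive_continuous R_AbsRing R_NormedModule); eexists.
  now apply is_derive_log.
- apply continuous_pos.
Qed.

Lemma continuous_pow (f : R -> R) (n : nat) (x : R) :
  continuous f x -> continuous (fun t => f t ^ n) x.
Proof.
intros Hf; apply (continuous_comp f (fun s => s ^ n)); [exact Hf|].
apply (@ex_derive_continuous R_AbsRing R_NormedModule); auto_derive; auto.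
Qed.

Lemma continuous_inv_log (ell r : R) : 0 < ell -> 0 <= r ->
  continuous (fun r => / (ell * (1 + r))) r.
Proof.
intros; apply (@ex_derive_continuous R_AbsRing R_NormedModule); auto_derive.
apply Rgt_not_eq, Rmult_lt_0_compat; lra.
Qed.

Lemma continuous_log_cut3' (ell r : R) : 0 < ell -> 0 <= r ->
  continuous (fun r => - 3 * log_cut ell r ^ 2 / (ell * (1 + r))) r.
Proof.
intros He Hr.
apply (continuous_mult (fun r => - 3 * log_cut ell r ^ 2) (fun r => / (ell * (1 + r)))).
- apply (continuous_scal_r (- 3) (fun r => log_cut ell r ^ 2)).
  now apply continuous_pow, continuous_log_cut.
- now apply continuous_inv_log.
Qed.

Lemma continuous_corrector' (k ell r : R) : 0 < ell -> 0 <= r ->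
  continuous (fun r => - k * (- 2 * log_cut ell r / (ell * (1 + r)) * kappa r +
           log_cut ell r ^ 2 * kappa' r)) r.
Proof.
intros He Hr.
assert (0 < 1 + r ^ 2) by (generalize (pow2_ge_0 r); lra).
apply (continuous_scal_r (- k) (fun r => - 2 * log_cut ell r / (ell * (1 + r)) * kappa r +
           log_cut ell r ^ 2 * kappa' r)).
apply (continuous_plus (fun r => - 2 * log_cut ell r / (ell * (1 + r)) * kappa r)
  (fun r => log_cut ell r ^ 2 * kappa' r)).
- apply (continuous_mult (fun r => - 2 * log_cut ell r / (ell * (1 + r))) kappa).
  + apply (continuous_mult (fun r => - 2 * log_cut ell r) (fun r => / (ell * (1 + r)))).
    * apply (continuous_scal_r (- 2) (log_cut ell)).
      now apply continuous_log_cut.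
    * now apply continuous_inv_log.
  + apply (@ex_derive_continuous R_AbsRing R_NormedModule); eexists.
    apply is_derive_kappa.
- apply (continuous_mult (fun r => log_cut ell r ^ 2) kappa').
  + now apply continuous_pow, continuous_log_cut.
  + unfold kappa'; apply (@ex_derive_continuous R_AbsRing R_NormedModule).
    auto_derive; nra.
Qed.

Lemma log_cut_le_1 (ell r : R) : 0 < ell -> 0 <= r -> log_cut ell r <= 1.
Proof.
intros He Hr; unfold log_cut, pos; apply Rmax_lub; [lra|].
assert (0 <= ln (1 + r)).
{ rewrite <- ln_1; destruct Hr as [Hr|<-]; [|rewrite Rplus_0_r; lra].
  apply Rlt_le, ln_increasing; lra. }
assert (0 <= ln (1 + r) / ell).
{ unfold Rdiv; apply Rmult_le_pos; [assumption|].
  now apply Rlt_le, Rinv_0_lt_compat. }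
lra.
Qed.

Lemma log_cut_eq_0 (ell r : R) : 0 < ell -> exp ell <= 1 + r -> log_cut ell r = 0.
Proof.
intros He Hr; unfold log_cut, pos; apply Rmax_left.
assert (ell <= ln (1 + r)).
{ rewrite <- (ln_exp ell) at 1; destruct Hr as [Hr| ->]; [|lra].
  apply Rlt_le, ln_increasing; [apply exp_pos|exact Hr]. }
assert (1 <= ln (1 + r) / ell); [|lra].
apply Rmult_le_reg_r with ell; [lra|].
unfold Rdiv; rewrite Rmult_assoc, Rinv_l; lra.
Qed.

Lemma log_cut_ge_half (ell r : R) :
  0 < ell -> 2 * ln (1 + r) <= ell -> / 2 <= log_cut ell r.
Proof.
intros He Hr; unfold log_cut, pos; apply Rle_trans with (2 := Rmax_r _ _).
assert (ln (1 + r) / ell <= / 2); [|lra].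
apply Rmult_le_reg_r with ell; [lra|].
unfold Rdiv; rewrite Rmult_assoc, Rinv_l; lra.
Qed.

(* [r * kappa r >= r / (1 + r)] absorbs the gradient of the cut-off, and
   [r * kappa r] increases only for small r. *)
Lemma cutoff_inequality (K ell Q r M d w1 w2 l1 l2 : R) :
  0 < K -> 0 < ell -> 0 <= Q <= 1 -> 0 <= M -> 0 < d ->
  r = (l1 ^ 2 + l2 ^ 2) / 2 -> w1 ^ 2 + w2 ^ 2 <= K * M * d ->
  let k := 9 * K / (4 * ell) in
  let total := Q ^ 3 * M + 3 * Q ^ 2 / (ell * (1 + r)) * (l1 * w1 + l2 * w2)
    + 2 * d * (- k * (Q ^ 2 * kappa r) +
        r * (- k * (- 2 * Q / (ell * (1 + r)) * kappa r + Q ^ 2 * kappa' r))) in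
  Q ^ 3 * M / 2 - 18 * K / ell * d <= total /\
  (2 <= r -> Q ^ 3 * M / 2 <= total).
Proof.
intros HK He HQ HM Hd Er Hw k total.
assert (Hr : 0 <= r) by (rewrite Er; generalize (pow2_ge_0 l1) (pow2_ge_0 l2); lra).
set (s := / (ell * (1 + r))).
assert (Hs : 0 < s).
{ apply Rinv_0_lt_compat, Rmult_lt_0_compat; lra. }
assert (Hk : 0 < k) by (apply Rdiv_lt_0_compat; lra).
(* Complete the square of Q w + 3 s K d l, use |l|^2 = 2 r and the bound on |w|^2, divide by K d and
   multiply by Q / 2. Half of the main term is spent. *)
assert (young : - (Q ^ 3 * M / 2) - 9 * K * Q * s ^ 2 * r * d <=
  3 * Q ^ 2 / (ell * (1 + r)) * (l1 * w1 + l2 * w2)).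
{ assert (A : 0 <= (Q * w1 + 3 * s * (K * d) * l1) ^ 2 +
                   (Q * w2 + 3 * s * (K * d) * l2) ^ 2)
    by (apply Rplus_le_le_0_compat; apply pow2_ge_0).
  assert (B : Q ^ 2 * (w1 ^ 2 + w2 ^ 2) <= Q ^ 2 * (K * M * d))
    by (apply Rmult_le_compat_l; [apply pow2_ge_0|exact Hw]).
  assert (C : 0 <= Q ^ 2 * M + 6 * s * Q * (l1 * w1 + l2 * w2)
                 + 18 * s ^ 2 * (K * d) * r).
  { apply Rmult_le_reg_l with (K * d); [now apply Rmult_lt_0_compat|].
    rewrite Er; nra. }
  assert (C' := Rmult_le_pos _ _ (proj1 HQ) C).
  unfold Rdiv; fold s; nra. }
(* The derivative of r kappa(r), the only factor of uncertain sign left in the corrector. *)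
set (om := kappa r + r * kappa' r).
assert (Ht : 2 * d * (- k * (Q ^ 2 * kappa r) +
        r * (- k * (- 2 * Q / (ell * (1 + r)) * kappa r + Q ^ 2 * kappa' r))) =
  4 * d * k * Q * s * (r * kappa r) - 2 * d * k * Q ^ 2 * om).
{ unfold om, Rdiv; fold s; ring. }
assert (p1 : 0 < 1 + r ^ 2) by (generalize (pow2_ge_0 r); lra).
assert (Hom : om = (2 + 2 * r - 2 * r ^ 2) / (1 + r ^ 2) ^ 2).
{ unfold om, kappa, kappa'; field; lra. }
(* The value of [k] satisfies 4 k / (1 + r) = 9 K s, so that the lower bound 1 / (1 + r) for [kappa]
   pays exactly for the loss in [young]. *)
assert (gain : 9 * K * Q * s ^ 2 * r * d <= 4 * d * k * Q * s * (r * kappa r)).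
{ assert (Hkap : / (1 + r) <= kappa r).
  { unfold kappa; apply Rmult_le_reg_r with ((1 + r) * (1 + r ^ 2)); [nra|].
    replace (/ (1 + r) * ((1 + r) * (1 + r ^ 2))) with (1 + r ^ 2) by (field; lra).
    replace ((r + 2) / (1 + r ^ 2) * ((1 + r) * (1 + r ^ 2)))
      with ((r + 2) * (1 + r)) by (field; lra).
    nra. }
  replace (9 * K * Q * s ^ 2 * r * d)
    with (4 * d * k * Q * s * r * (/ (1 + r))) by (unfold s, k; field; lra).
  rewrite <- (Rmult_assoc _ r (kappa r)).
  apply Rmult_le_compat_l; [|exact Hkap].
  revert Hk Hs; generalize k s; intros; repeat apply Rmult_le_pos; lra. }
assert (Q2 : 0 <= Q ^ 2 <= 1).
{ split; [apply pow2_ge_0|]; rewrite <- (pow1 2); apply pow_incr; lra. }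
unfold total; rewrite Ht; clear total Ht.
split; [|intros Hr2].
(* The crude bound 4 makes the error 2 d k * 4, which is the 18 K d / ell of the statement. *)
- assert (om <= 4).
  { rewrite Hom; apply Rmult_le_reg_r with ((1 + r ^ 2) ^ 2); [now apply pow_lt|].
    replace ((2 + 2 * r - 2 * r ^ 2) / (1 + r ^ 2) ^ 2 * (1 + r ^ 2) ^ 2)
      with (2 + 2 * r - 2 * r ^ 2) by (field; lra).
    nra. }
  assert (Q ^ 2 * om <= 4).
  { destruct (Rle_or_lt om 0); nra. }
  assert (2 * d * k * (Q ^ 2 * om) <= 2 * d * k * 4).
  { apply Rmult_le_compat_l; [|assumption].
    revert Hk; generalize k; intros; repeat apply Rmult_le_pos; lra. }
  assert (2 * d * k * 4 = 18 * K / ell * d) by (unfold k; field; lra).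
  lra.
- assert (om <= 0).
  { rewrite Hom; apply Rmult_le_reg_r with ((1 + r ^ 2) ^ 2); [now apply pow_lt|].
    replace ((2 + 2 * r - 2 * r ^ 2) / (1 + r ^ 2) ^ 2 * (1 + r ^ 2) ^ 2)
      with (2 + 2 * r - 2 * r ^ 2) by (field; lra).
    nra. }
  assert (2 * d * k * Q ^ 2 * om <= 0); [|lra].
  assert (0 <= 2 * d * k * Q ^ 2) by
    (revert Hk; generalize k; intros; repeat apply Rmult_le_pos; lra).
  nra.
Qed.

(** * The Hessian vanishes *)

Lemma C1_J (g g1 g2 : R -> R) (c0 c L : R) :
  energy_density g g1 g2 c0 c L ->
  C1 (J11 g g1 L)
     (fun p q => g1 (rad p q) * p / rad p q
        - ratio' g1 g2 (rad p q) * p / rad p q * q ^ 2)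
     (fun p q => g1 (rad p q) * q / rad p q
        - (ratio' g1 g2 (rad p q) * q / rad p q * q ^ 2 + ratio g1 (rad p q) * (2 * q)))
  /\ C1 (J12 g1)
     (fun p q => ratio' g1 g2 (rad p q) * p / rad p q * (p * q) + ratio g1 (rad p q) * q)
     (fun p q => ratio' g1 g2 (rad p q) * q / rad p q * (p * q) + ratio g1 (rad p q) * p)
  /\ C1 (J22 g g1 L)
     (fun p q => g1 (rad p q) * p / rad p q
        - (ratio' g1 g2 (rad p q) * p / rad p q * p ^ 2 + ratio g1 (rad p q) * (2 * p)))
     (fun p q => g1 (rad p q) * q / rad p q
        - ratio' g1 g2 (rad p q) * q / rad p q * p ^ 2).
Proof.
intros E.
assert (H0 := C1_energy _ _ _ _ _ _ E).
assert (H1 := C1_plus _ _ _ _ _ _ (C1_const (1 + L)) H0).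
split; [|split].
- eapply C1_ext; [| | |exact (C1_minus _ _ _ _ _ _ H1
    (C1_ratio_quadratic _ _ _ _ _ _ 0 2 E eq_refl))];
    intros; unfold J11; simpl; unfold Rdiv; ring.
- eapply C1_ext; [| | |exact (C1_ratio_quadratic _ _ _ _ _ _ 1 1 E eq_refl)];
    intros; unfold J12; simpl; unfold Rdiv; ring.
- eapply C1_ext; [| | |exact (C1_minus _ _ _ _ _ _ H1
    (C1_ratio_quadratic _ _ _ _ _ _ 2 0 E eq_refl))];
    intros; unfold J22; simpl; unfold Rdiv; ring.
Qed.

Lemma C1_weight_field (g g1 g2 : R -> R) (c0 c L : R) :
  energy_density g g1 g2 c0 c L ->
  C1 (fun p q => weight g g1 (rad p q) * p)
     (fun p q => weight' g g1 g2 (rad p q) * p / rad p q * p + weight g g1 (rad p q))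
     (fun p q => weight' g g1 g2 (rad p q) * q / rad p q * p)
  /\ C1 (fun p q => weight g g1 (rad p q) * q)
     (fun p q => weight' g g1 g2 (rad p q) * p / rad p q * q)
     (fun p q => weight' g g1 g2 (rad p q) * q / rad p q * q + weight g g1 (rad p q)).
Proof.
intros E; split.
- eapply C1_ext; [| | |exact (C1_weight_linear _ _ _ _ _ _ 1 0 E eq_refl)];
    intros; simpl; unfold Rdiv; ring.
- eapply C1_ext; [| | |exact (C1_weight_linear _ _ _ _ _ _ 0 1 E eq_refl)];
    intros; simpl; unfold Rdiv; ring.
Qed.

(* The cofactor matrix [c, -b; -b, a] of a Hessian is divergence free. *)
Lemma C1_cofactor_field (z z1 z2 a a1 a2 b b2 c c2 X X1 X2 Y Y1 Y2 : R -> R -> R) :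
  C1 z z1 z2 -> C1 a a1 a2 -> C1 b a2 b2 -> C1 c b2 c2 -> C1 X X1 X2 -> C1 Y Y1 Y2 ->
  exists V1 V2 W1 W2,
    C1 (fun x y => z x y * (c x y * X x y - b x y * Y x y)) V1 V2 /\
    C1 (fun x y => z x y * (a x y * Y x y - b x y * X x y)) W1 W2 /\
    forall x y, V1 x y + W2 x y =
      z1 x y * (c x y * X x y - b x y * Y x y) +
      z2 x y * (a x y * Y x y - b x y * X x y) +
      z x y * (c x y * X1 x y - b x y * (X2 x y + Y1 x y) + a x y * Y2 x y).
Proof.
intros Hz Ha Hb Hc HX HY.
do 4 eexists; split; [|split].
- eapply C1_mult; [exact Hz|]; apply C1_minus; apply C1_mult; eassumption.
- eapply C1_mult; [exact Hz|]; apply C1_minus; apply C1_mult; eassumption.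
- intros x y; simpl; ring.
Qed.

(** Differentiating x . Lambda(s x) along the ray gives x . Lambda(x) >= |x|^2, and the square of x
    - Lambda(x) being nonnegative finishes. This makes [r] proper, so functions of compact support
    in [r] have compact support in the plane. *)
Lemma expanding (F G A B C : R -> R -> R) :
  C1 F A B -> C1 G B C -> F 0 0 = 0 -> G 0 0 = 0 ->
  (forall x y v w, v ^ 2 + w ^ 2 <=
     A x y * v ^ 2 + 2 * B x y * (v * w) + C x y * w ^ 2) ->
  forall x y, x ^ 2 + y ^ 2 <= F x y ^ 2 + G x y ^ 2.
Proof.
intros HF HG F0 G0 Hpos x y.
assert (lin : forall k s, derivable_pt_lim (fun s => k * s) s k).
{ intros k s; apply is_derive_Reals; auto_derive; auto; ring. }
assert (D : forall K K1 K2, C1 K K1 K2 -> forall s, is_derive (fun s => K (x * s) (y * s)) s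
   (K1 (x * s) (y * s) * x + K2 (x * s) (y * s) * y)).
{ intros K K1 K2 HK s; apply is_derive_Reals.
  apply (derivable_pt_lim_comp_2d K (fun s => x * s) (fun s => y * s)).
  - apply HK.
  - apply lin.
  - apply lin. }
assert (DF := D _ _ _ HF); assert (DG := D _ _ _ HG).
generalize (increment_ge (fun s => x * F (x * s) (y * s) + y * G (x * s) (y * s))
  (fun s => x * (A (x * s) (y * s) * x + B (x * s) (y * s) * y) +
            y * (B (x * s) (y * s) * x + C (x * s) (y * s) * y))
  (x ^ 2 + y ^ 2) 0 1).
intros I; assert (J : (x ^ 2 + y ^ 2) * (1 - 0) <= x * F x y + y * G x y).
{ replace (x * F x y + y * G x y) with (x * F (x * 1) (y * 1) + y * G (x * 1) (y * 1) -
    (x * F (x * 0) (y * 0) + y * G (x * 0) (y * 0)))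
    by (rewrite !Rmult_1_r, !Rmult_0_r, F0, G0; ring).
  apply I; [|lra|].
  - intros s; apply (is_derive_plus (fun s => x * F (x * s) (y * s))
      (fun s => y * G (x * s) (y * s))); apply is_derive_scal; auto.
  - intros s _; generalize (Hpos (x * s) (y * s) x y); lra. }
generalize (pow2_ge_0 (x - F x y)) (pow2_ge_0 (y - G x y)); nra.
Qed.

(** By uniform continuity, walking from the origin in [n] equal steps shorter than [d] changes [F]
    by less than 1 per step. *)
Lemma bounded_on_box (F : R -> R -> R) (l : R) :
  0 < l -> (forall x y, continuity_2d_pt F x y) ->
  exists B, 0 < B /\ forall x y, Rabs x <= l -> Rabs y <= l -> F x y <= B.
Proof.
intros Hl HF.
destruct (uniform_continuity_2d F (- l) l (- l) l
  ltac:(auto) (mkposreal 1 Rlt_0_1)) as [d Hd]; simpl in Hd.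
destruct (archimed (l / d)) as [Hn _].
assert (Hld : 0 < l / d) by (apply Rdiv_lt_0_compat; [lra|apply cond_pos]).
set (n := Z.to_nat (up (l / d))).
assert (Hup : (0 <= up (l / d))%Z) by (apply le_IZR; lra).
assert (En : INR n = IZR (up (l / d)))
  by (unfold n; rewrite INR_IZR_INZ, Znat.Z2Nat.id; auto).
assert (n0 : 0 < INR n) by lra.
assert (step : l / INR n < d).
{ apply Rmult_lt_reg_r with (INR n); [lra|].
  replace (l / INR n * INR n) with (l / d * d)
    by (field; generalize (cond_pos d); lra).
  rewrite Rmult_comm; apply Rmult_lt_compat_l; [apply cond_pos|lra]. }
exists (Rabs (F 0 0) + INR n + 1); split; [generalize (Rabs_pos (F 0 0)); lra|].
intros x y Hx Hy.
assert (K : forall j, (j <= n)%nat ->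
  F (x * (INR j / INR n)) (y * (INR j / INR n)) <= F 0 0 + INR j).
{ induction j as [|j IH]; intros Hj.
  - replace (INR 0 / INR n) with 0 by (simpl; field; lra).
    rewrite !Rmult_0_r; simpl; lra.
  - assert (frac : forall i, (i <= n)%nat -> 0 <= INR i / INR n <= 1).
    { intros i Hi; apply le_INR in Hi; generalize (pos_INR i); intros.
      split; [apply Rmult_le_pos; [lra|apply Rlt_le, Rinv_0_lt_compat; lra]|].
      apply Rmult_le_reg_r with (INR n); [lra|].
      replace (INR i / INR n * INR n) with (INR i) by (field; lra); lra. }
    assert (inbox : forall z i, Rabs z <= l -> (i <= n)%nat ->
      - l <= z * (INR i / INR n) <= l).
    { intros z i Hz Hi; apply Rabs_le_between; rewrite Rabs_mult.
      destruct (frac i Hi) as [f0 f1]; rewrite (Rabs_pos_eq (INR i / INR n)) by lra.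
      generalize (Rabs_pos z); nra. }
    assert (close : forall z, Rabs z <= l ->
      Rabs (z * (INR (S j) / INR n) - z * (INR j / INR n)) < d).
    { intros z Hz; rewrite S_INR.
      replace (z * ((INR j + 1) / INR n) - z * (INR j / INR n)) with (z * / INR n)
        by (field; lra).
      assert (0 < / INR n) by (apply Rinv_0_lt_compat; lra).
      rewrite Rabs_mult, (Rabs_pos_eq (/ INR n)) by lra.
      apply Rle_lt_trans with (2 := step); apply Rmult_le_compat_r; lra. }
    assert (j <= n)%nat as Hj' by lia.
    assert (Q := Hd _ _ _ _ (inbox x j Hx Hj') (inbox y j Hy Hj')
      (inbox x (S j) Hx Hj) (inbox y (S j) Hy Hj) (close x Hx) (close y Hy)).
    apply Rabs_lt_between in Q; rewrite S_INR in *; generalize (IH Hj'); lra. }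
generalize (K n (le_n n)) (Rle_abs (F 0 0)).
replace (INR n / INR n) with 1 by (field; lra); rewrite !Rmult_1_r; lra.
Qed.

(** The equation in nondivergence form, multiplied by t^2: g'' weights the second derivative along
    the gradient and g' / t the one across it. *)
Definition elliptic (g1 g2 : R -> R) (p q a b c : R) : Prop :=
  g2 (rad p q) * (p ^ 2 * a + 2 * p * q * b + q ^ 2 * c) +
  ratio g1 (rad p q) * (q ^ 2 * a - 2 * p * q * b + p ^ 2 * c) = 0.

(** Noether's identity: the two curls are -q and p times the divergence of the flux. At a critical
    point every term has a vanishing factor, so the equation is only needed elsewhere. *)
Lemma J_curl_free (g1 g2 : R -> R) (p q a b c : R) :
  (rad p q <> 0 -> elliptic g1 g2 p q a b c) ->
  let t := rad p q in
  let al := ratio g1 t in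
  let be := ratio' g1 g2 t in
  (g1 t * p / t - be * p / t * q ^ 2) * b +
  (g1 t * q / t - (be * q / t * q ^ 2 + al * (2 * q))) * c =
  (be * p / t * (p * q) + al * q) * a + (be * q / t * (p * q) + al * p) * b /\
  (be * p / t * (p * q) + al * q) * b + (be * q / t * (p * q) + al * p) * c =
  (g1 t * p / t - (be * p / t * p ^ 2 + al * (2 * p))) * a +
  (g1 t * q / t - be * q / t * p ^ 2) * b.
Proof.
intros H; unfold elliptic in H; generalize (rad_sqr p q).
destruct (Req_dec (rad p q) 0) as [H0|H0].
- destruct (rad_eq_0 p q H0) as [-> ->]; intros _; unfold Rdiv; split; ring.
- specialize (H H0); revert H; unfold ratio, ratio'; set (t := rad p q) in *.
  intros H Et; simpl.
  set (E := g2 t * (p ^ 2 * a + 2 * p * q * b + q ^ 2 * c) +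
    g1 t / t * (q ^ 2 * a - 2 * p * q * b + p ^ 2 * c)) in *.
  (* The expanded divergence of the flux, recovered by dividing the elliptic form by t^2. *)
  assert (E' : (g2 t - g1 t / t) / t / t * (p ^ 2 * a + 2 * p * q * b + q ^ 2 * c)
    + g1 t / t * (a + c) = 0).
  { apply Rmult_eq_reg_r with (t ^ 2); [|now apply pow_nonzero].
    rewrite Rmult_0_l, <- H; unfold E.
    transitivity ((g2 t - g1 t / t) * (p ^ 2 * a + 2 * p * q * b + q ^ 2 * c)
      + g1 t / t * (a + c) * t ^ 2); [field; exact H0|].
    rewrite Et; ring. }
  clearbody E.
  split; apply Rminus_diag_uniq.
  + transitivity (- q * ((g2 t - g1 t / t) / t / t *
      (p ^ 2 * a + 2 * p * q * b + q ^ 2 * c) + g1 t / t * (a + c)));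
      [field; exact H0|rewrite E'; ring].
  + transitivity (p * ((g2 t - g1 t / t) / t / t *
      (p ^ 2 * a + 2 * p * q * b + q ^ 2 * c) + g1 t / t * (a + c)));
      [field; exact H0|rewrite E'; ring].
Qed.

Lemma ratio_mult_sqr (g1 : R -> R) (t : R) : ratio g1 t * t ^ 2 = t * g1 t.
Proof.
unfold ratio; destruct (Req_dec t 0) as [->|H]; [ring|field; exact H].
Qed.

Lemma J_det (g g1 : R -> R) (L p q : R) :
  J11 g g1 L p q * J22 g g1 L p q - J12 g1 p q ^ 2 =
  (1 + L + (g (rad p q) - g 0)) *
  (1 + L + (g (rad p q) - g 0) - rad p q * g1 (rad p q)).
Proof.
unfold J11, J12, J22; rewrite <- ratio_mult_sqr, rad_sqr; ring.
Qed.

Lemma eigenvalue_ge_1 (g g1 g2 : R -> R) (c0 c L p q : R) :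
  energy_density g g1 g2 c0 c L ->
  1 <= 1 + L + (g (rad p q) - g 0) - rad p q * g1 (rad p q) <=
  1 + L + (g (rad p q) - g 0).
Proof.
intros E; destruct (rad_pos p q) as [Hr|Hr].
- generalize (ed_legendre _ _ _ _ _ _ E _ Hr) (ratio_bounds _ _ _ _ _ _ _ E Hr).
  rewrite <- (ratio_mult_sqr g1); intros K1 [K2 _].
  generalize (Rmult_le_pos _ _ (Rlt_le _ _ K2) (pow2_ge_0 (rad p q))); lra.
- rewrite <- Hr; generalize (ed_L _ _ _ _ _ _ E); lra.
Qed.

(** The quadratic form of J is the smaller eigenvalue times |(v, w)|^2 plus [ratio g1] times (p v +
    q w)^2. *)
Lemma J_ge_1 (g g1 g2 : R -> R) (c0 c L p q v w : R) :
  energy_density g g1 g2 c0 c L ->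
  v ^ 2 + w ^ 2 <= J11 g g1 L p q * v ^ 2 + 2 * J12 g1 p q * (v * w) +
    J22 g g1 L p q * w ^ 2.
Proof.
intros E; assert (K := eigenvalue_ge_1 _ _ _ _ _ _ p q E).
assert (al : 0 <= ratio g1 (rad p q)).
{ destruct (rad_pos p q) as [Hr|Hr].
  - apply Rlt_le, (ratio_bounds _ _ _ _ _ _ _ E Hr).
  - rewrite <- Hr; unfold ratio, Rdiv; rewrite Rinv_0; lra. }
rewrite <- ratio_mult_sqr, rad_sqr in K.
assert (A := Rmult_le_pos _ _ al (pow2_ge_0 (p * v + q * w))).
assert (B := Rmult_le_compat_r (v ^ 2 + w ^ 2) _ _
  ltac:(generalize (pow2_ge_0 v) (pow2_ge_0 w); lra) (proj1 K)).
unfold J11, J12, J22.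
set (lam := 1 + L + (g (rad p q) - g 0)) in *; set (r := ratio g1 (rad p q)) in *.
nra.
Qed.

(* The key estimate, read off in the basis of the gradient and its normal: the
   equation bounds each entry of the cofactor matrix by [- det (D^2 u)]. *)
Lemma key_estimate (g g1 g2 : R -> R) (c0 c L : R) :
  energy_density g g1 g2 c0 c L ->
  exists K, 0 < K /\ forall p q a b d,
    (rad p q <> 0 -> elliptic g1 g2 p q a b d) ->
    let N := weight' g g1 g2 (rad p q) * p / rad p q * p + weight g g1 (rad p q) +
      (weight' g g1 g2 (rad p q) * q / rad p q * q + weight g g1 (rad p q)) in
    let M := N * (b ^ 2 - a * d) in
    let Z1 := d * (weight g g1 (rad p q) * p) - b * (weight g g1 (rad p q) * q) in
    let Z2 := a * (weight g g1 (rad p q) * q) - b * (weight g g1 (rad p q) * p) in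
    let D := J11 g g1 L p q * J22 g g1 L p q - J12 g1 p q ^ 2 in
    0 <= M /\
    (rad p q <> 0 -> M <= 0 -> a = 0 /\ b = 0 /\ d = 0) /\
    (J11 g g1 L p q * Z1 + J12 g1 p q * Z2) ^ 2 +
    (J12 g1 p q * Z1 + J22 g g1 L p q * Z2) ^ 2 <= K * M * D.
Proof.
intros E; destruct (eigenvalue_bounds _ _ _ _ _ _ E) as [K [HK Hbd]].
exists K; split; [exact HK|]; intros p q a b d Heq N M Z1 Z2 D.
(* At a critical point the weight is 0, so the field, its divergence and both sides of the estimate
   vanish. *)
destruct (Req_dec (rad p q) 0) as [H0|H0].
- destruct (rad_eq_0 p q H0) as [-> ->].
  assert (W0 : weight g g1 (rad 0 0) = 0)
    by (rewrite rad_0; unfold weight, excess, Rdiv; ring).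
  assert (N0 : N = 0) by (unfold N; rewrite W0; unfold Rdiv; ring).
  assert (M0 : M = 0) by (unfold M; rewrite N0; ring).
  rewrite M0; split; [lra|]; split; [easy|].
  unfold Z1, Z2; rewrite W0; apply Req_le; ring.
- specialize (Heq H0); unfold elliptic in Heq.
  assert (Hr : 0 < rad p q) by (generalize (rad_pos p q); lra).
  assert (Et := rad_sqr p q).
  destruct (Hbd _ Hr) as [Hmu [B1 B2]].
  destruct (ed_g2_pos _ _ _ _ _ _ E _ Hr) as [Hg2 _].
  destruct (ratio_bounds _ _ _ _ _ _ _ E Hr) as [Hal _].
  destruct (excess_bounds _ _ _ _ _ _ _ E Hr) as [Hy _].
  destruct (slope_bounds _ _ _ _ _ _ _ E Hr) as [Hs1 [_ Hs2]].
  assert (Eal := ratio_mult_sqr g1 (rad p q)).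
  assert (ED := J_det g g1 L p q).
  unfold J11, J12, J22, weight, weight' in *.
  set (t := rad p q) in *; set (al := ratio g1 t) in *; set (y := excess g g1 t) in *.
  set (n := slope g2 t) in *; set (lam := 1 + L + (g t - g 0)) in *.
  set (mu := lam - t * g1 t) in *.
  (* Up to sign, [P], [Q], [S] are t^2 times the Hessian entries in the orthonormal basis of
     gradient and normal: along, across and mixed. *)
  set (P := p ^ 2 * a + 2 * p * q * b + q ^ 2 * d) in *.
  set (Q := q ^ 2 * a - 2 * p * q * b + p ^ 2 * d) in *.
  set (S := (a - d) * (p * q) + b * (q ^ 2 - p ^ 2)).
  assert (t2 : 0 < t ^ 2) by (now apply pow_lt).
  (* The terms in Y / t^2 cancel: the divergence is (Y^2)' / t. *)
  assert (EN : N = 2 * y * n).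
  { unfold N.
    transitivity (2 * (y / t) * (n - y / t ^ 2) * (p ^ 2 + q ^ 2) / t + 2 * (y / t) ^ 2);
      [field; lra|rewrite <- Et; field; lra]. }
  assert (Edet : t ^ 4 * (b ^ 2 - a * d) = S ^ 2 - P * Q).
  { replace (t ^ 4) with ((t ^ 2) ^ 2) by ring; rewrite Et; unfold S, P, Q; ring. }
  (* The equation reads g'' P = - al Q; eliminating [P] makes - det H a positive form in [S] and
     [Q]. *)
  assert (EM : t ^ 4 * g2 t * M = 2 * y * n * (g2 t * S ^ 2 + al * Q ^ 2)).
  { unfold M; rewrite EN.
    transitivity (2 * y * n * (g2 t * (t ^ 4 * (b ^ 2 - a * d)))); [ring|].
    rewrite Edet.
    replace (g2 t * (S ^ 2 - P * Q)) with (g2 t * S ^ 2 - (g2 t * P) * Q) by ring.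
    replace (g2 t * P) with (- (al * Q)) by lra; ring. }
  assert (t4 : 0 < t ^ 4) by now apply pow_lt.
  assert (Hn : 0 < n) by lra.
  clearbody al y n.
  assert (HSQ : 0 <= g2 t * S ^ 2 + al * Q ^ 2).
  { apply Rplus_le_le_0_compat; apply Rmult_le_pos; try apply pow2_ge_0; lra. }
  assert (t4g : 0 < t ^ 4 * g2 t) by now apply Rmult_lt_0_compat.
  assert (yn : 0 < 2 * y * n) by (apply Rmult_lt_0_compat; lra).
  split; [|split].
  + apply Rmult_le_reg_l with (t ^ 4 * g2 t); [exact t4g|].
    rewrite Rmult_0_r, EM; apply Rmult_le_pos; lra.
  + intros _ HM.
    assert (Z : g2 t * S ^ 2 + al * Q ^ 2 <= 0).
    { apply Rmult_le_reg_l with (2 * y * n); [exact yn|].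
      rewrite Rmult_0_r, <- EM; nra. }
    assert (S0 : S = 0).
    { apply Rsqr_0_uniq; unfold Rsqr; generalize (pow2_ge_0 S) (pow2_ge_0 Q); nra. }
    assert (Q0 : Q = 0).
    { apply Rsqr_0_uniq; unfold Rsqr; generalize (pow2_ge_0 S) (pow2_ge_0 Q); nra. }
    assert (P0 : P = 0) by (rewrite Q0 in Heq; apply Rmult_eq_reg_l with (g2 t); lra).
    assert (F : (t ^ 2) ^ 2 * (a ^ 2 + 2 * b ^ 2 + d ^ 2) = P ^ 2 + 2 * S ^ 2 + Q ^ 2)
      by (rewrite Et; unfold P, S, Q; ring).
    rewrite P0, S0, Q0 in F.
    assert (F' : a ^ 2 + 2 * b ^ 2 + d ^ 2 = 0).
    { apply Rmult_eq_reg_l with ((t ^ 2) ^ 2); [lra|].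
      apply pow_nonzero; lra. }
    repeat split; nra.
  (* The cofactor matrix applied to p has components Q / t along and S / t across, up to sign; J
     multiplies them by its eigenvalues [lam] and [mu]. *)
  + assert (EZ : t ^ 4 * (((lam - al * q ^ 2) * Z1 + al * (p * q) * Z2) ^ 2 +
      (al * (p * q) * Z1 + (lam - al * p ^ 2) * Z2) ^ 2) =
      y ^ 4 / t ^ 2 * (lam ^ 2 * Q ^ 2 + mu ^ 2 * S ^ 2)).
    { set (k := (y / t) ^ 2) in *.
      replace (y ^ 4 / t ^ 2) with (k ^ 2 * t ^ 2) by (unfold k; field; lra).
      unfold mu; rewrite <- Eal.
      replace (t ^ 4) with (t ^ 2 * t ^ 2) by ring; rewrite Et.
      unfold Z1, Z2, Q, S; ring. }
    apply Rmult_le_reg_l with (t ^ 4); [exact t4|].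
    rewrite EZ; clear EZ.
    assert (hlam : 0 < lam).
    { assert (0 < t * g1 t) by (rewrite <- Eal; now apply Rmult_lt_0_compat).
      unfold mu in Hmu; lra. }
    assert (Main : y ^ 4 * (lam ^ 2 * Q ^ 2 + mu ^ 2 * S ^ 2) * g2 t <=
      t ^ 2 * (K * (2 * y * n * (g2 t * S ^ 2 + al * Q ^ 2)) * (lam * mu))).
    (* The coefficients of Q^2 and S^2 are compared separately: [C1'] rests on g'' <= n and mu >= 1,
       [C2'] on 2 <= n (1 + t)^3. *)
    { assert (C1' : y ^ 3 * lam * g2 t <= 2 * K * t ^ 2 * n * mu * al).
      { rewrite <- Eal in B1.
        apply Rle_trans with (2 * K * (al * t ^ 2) * n).
        - apply Rmult_le_compat; try lra.
          apply Rmult_le_pos; [apply pow_le|]; lra.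
        - assert (0 < K * t ^ 2 * n * al)
            by (repeat (apply Rmult_lt_0_compat; [|assumption]); assumption).
          nra. }
      assert (C2' : y ^ 3 * mu <= 2 * K * t ^ 2 * n * lam).
      { apply Rmult_le_reg_r with ((1 + t) ^ 3); [apply pow_lt; lra|].
        apply Rle_trans with (1 := B2).
        assert (0 < K * t ^ 2 * lam).
        { repeat (apply Rmult_lt_0_compat; [|assumption]); assumption. }
        nra. }
      assert (T1 : y ^ 3 * lam * g2 t * (y * lam * Q ^ 2) <=
        2 * K * t ^ 2 * n * mu * al * (y * lam * Q ^ 2)).
      { apply Rmult_le_compat_r; [|exact C1'].
        apply Rmult_le_pos; [apply Rmult_le_pos; lra|apply pow2_ge_0]. }
      assert (T2 : y ^ 3 * mu * (y * mu * g2 t * S ^ 2) <=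
        2 * K * t ^ 2 * n * lam * (y * mu * g2 t * S ^ 2)).
      { apply Rmult_le_compat_r; [|exact C2'].
        apply Rmult_le_pos; [repeat apply Rmult_le_pos; lra|apply pow2_ge_0]. }
      lra. }
    assert (ED' : D = lam * mu) by exact ED.
    apply Rmult_le_reg_r with (t ^ 2 * g2 t); [now apply Rmult_lt_0_compat|].
    replace (y ^ 4 / t ^ 2 * (lam ^ 2 * Q ^ 2 + mu ^ 2 * S ^ 2) * (t ^ 2 * g2 t))
      with (y ^ 4 * (lam ^ 2 * Q ^ 2 + mu ^ 2 * S ^ 2) * g2 t) by (field; lra).
    apply Rle_trans with (1 := Main); apply Req_le.
    rewrite <- EM, ED'; ring.
Qed.

(** The curl equations also allow the partials of J to be shared between entries, so that J has the
    shape of a Hessian and [C1_cofactor_field] applies to it as to D^2 u. *)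
Lemma potentials (g g1 g2 : R -> R) (c0 c L : R) (p q a b d : R -> R -> R) :
  energy_density g g1 g2 c0 c L -> C1 p a b -> C1 q b d ->
  (forall x y, rad (p x y) (q x y) <> 0 ->
     elliptic g1 g2 (p x y) (q x y) (a x y) (b x y) (d x y)) ->
  let A x y := J11 g g1 L (p x y) (q x y) in
  let B x y := J12 g1 (p x y) (q x y) in
  let C x y := J22 g g1 L (p x y) (q x y) in
  exists A1 A2 B2 C2 F G,
    C1 A A1 A2 /\ C1 B A2 B2 /\ C1 C B2 C2 /\ C1 F A B /\ C1 G B C /\
    F 0 0 = 0 /\ G 0 0 = 0.
Proof.
intros E Hp Hq Heq A B C.
destruct (C1_J _ _ _ _ _ _ E) as [H11 [H12 H22]].
assert (HA := C1_comp _ _ _ _ _ _ _ _ _ H11 Hp Hq).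
assert (HB := C1_comp _ _ _ _ _ _ _ _ _ H12 Hp Hq).
assert (HC := C1_comp _ _ _ _ _ _ _ _ _ H22 Hp Hq).
assert (curl := fun x y => J_curl_free g1 g2 _ _ _ _ _ (Heq x y)).
destruct (poincare _ _ _ _ _ _ HA HB) as [F [HF F0]];
  [intros x y; exact (proj1 (curl x y))|].
destruct (poincare _ _ _ _ _ _ HB HC) as [G [HG G0]];
  [intros x y; exact (proj2 (curl x y))|].
do 4 eexists; exists F, G.
split; [exact HA|]; split; [|split]; [| |repeat (split; [eassumption|]); assumption].
- eapply C1_ext; [| | |exact HB]; intros x y; [reflexivity| |reflexivity].
  symmetry; exact (proj1 (curl x y)).
- eapply C1_ext; [| | |exact HC]; intros x y; [reflexivity| |reflexivity].
  symmetry; exact (proj2 (curl x y)).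
Qed.

(** By [key_estimate] it is enough that [M], which is - det H times div X, is not positive. If it
    were positive at a point, the balance of one compactly supported field would fail for an
    explicit large [ell]; no limit is taken. *)
Lemma hessian_eq_0 (g g1 g2 : R -> R) (c0 c L : R)
  (p q a a1 a2 b b2 d d2 : R -> R -> R) :
  energy_density g g1 g2 c0 c L ->
  C1 p a b -> C1 q b d -> C1 a a1 a2 -> C1 b a2 b2 -> C1 d b2 d2 ->
  (forall x y, rad (p x y) (q x y) <> 0 ->
     elliptic g1 g2 (p x y) (q x y) (a x y) (b x y) (d x y)) ->
  forall x y, rad (p x y) (q x y) <> 0 -> a x y = 0 /\ b x y = 0 /\ d x y = 0.
Proof.
intros E Hp Hq Ha Hb Hd Heq x0 y0 Hr0.
destruct (key_estimate _ _ _ _ _ _ E) as [K [HK key]].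
destruct (potentials _ _ _ _ _ _ p q a b d E Hp Hq Heq)
  as [A1 [A2 [B2 [C2 [F [G [HA [HB [HC [HF [HG [F0 G0]]]]]]]]]]]].
set (A := fun x y => J11 g g1 L (p x y) (q x y)) in *.
set (B := fun x y => J12 g1 (p x y) (q x y)) in *.
set (C := fun x y => J22 g g1 L (p x y) (q x y)) in *.
destruct (C1_weight_field _ _ _ _ _ _ E) as [HW1 HW2].
assert (HX := C1_comp _ _ _ _ _ _ _ _ _ HW1 Hp Hq).
assert (HY := C1_comp _ _ _ _ _ _ _ _ _ HW2 Hp Hq).
set (N := fun p q => weight' g g1 g2 (rad p q) * p / rad p q * p + weight g g1 (rad p q) +
      (weight' g g1 g2 (rad p q) * q / rad p q * q + weight g g1 (rad p q))).
set (M := fun x y => N (p x y) (q x y) * (b x y ^ 2 - a x y * d x y)).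
apply (key _ _ _ _ _ (Heq x0 y0)); [exact Hr0|]; fold (N (p x0 y0) (q x0 y0)).
change (M x0 y0 <= 0).
assert (M_ge_0 : forall x y, 0 <= M x y)
  by (intros x y; apply (key _ _ _ _ _ (Heq x y))).
set (Z1 := fun x y => d x y * (weight g g1 (rad (p x y) (q x y)) * p x y)
  - b x y * (weight g g1 (rad (p x y) (q x y)) * q x y)).
set (Z2 := fun x y => a x y * (weight g g1 (rad (p x y) (q x y)) * q x y)
  - b x y * (weight g g1 (rad (p x y) (q x y)) * p x y)).
set (D := fun x y => A x y * C x y - B x y ^ 2).
assert (keyx : forall x y, (A x y * Z1 x y + B x y * Z2 x y) ^ 2 +
    (B x y * Z1 x y + C x y * Z2 x y) ^ 2 <= K * M x y * D x y)
  by (intros x y; apply (key _ _ _ _ _ (Heq x y))).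
clear key.
assert (D_pos : forall x y, 0 < D x y).
{ intros x y; unfold D, A, B, C; rewrite J_det.
  assert (I := eigenvalue_ge_1 _ _ _ _ _ _ (p x y) (q x y) E).
  apply Rmult_lt_0_compat; lra. }
set (r := fun x y => / 2 * (F x y * F x y + G x y * G x y)).
assert (Hr : C1 r (fun x y => A x y * F x y + B x y * G x y)
                  (fun x y => B x y * F x y + C x y * G x y)).
{ eapply C1_ext; [| | |exact (C1_scal (/ 2) _ _ _ (C1_plus _ _ _ _ _ _
    (C1_mult _ _ _ _ _ _ HF HF) (C1_mult _ _ _ _ _ _ HG HG)))];
    intros; simpl; [reflexivity|field|field]. }
assert (Er : forall x y, r x y = (F x y ^ 2 + G x y ^ 2) / 2)
  by (intros; unfold r; field).
assert (r_ge : forall x y, (x ^ 2 + y ^ 2) / 2 <= r x y).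
{ intros x y; rewrite Er.
  assert (I := expanding F G A B C HF HG F0 G0
    (fun x y v w => J_ge_1 _ _ _ _ _ _ (p x y) (q x y) v w E) x y); lra. }
assert (r_pos : forall x y, 0 <= r x y).
{ intros x y; apply Rle_trans with (2 := r_ge x y).
  generalize (pow2_ge_0 x) (pow2_ge_0 y); lra. }
assert (cA := fun x y => C1_continuity _ _ _ x y HA).
assert (cB := fun x y => C1_continuity _ _ _ x y HB).
assert (cC := fun x y => C1_continuity _ _ _ x y HC).
assert (ca := fun x y => C1_continuity _ _ _ x y Ha).
assert (cb := fun x y => C1_continuity _ _ _ x y Hb).
assert (cd := fun x y => C1_continuity _ _ _ x y Hd).
assert (cp := fun x y => C1_continuity _ _ _ x y Hp).
assert (cq := fun x y => C1_continuity _ _ _ x y Hq).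
assert (cont_M : forall x y, continuity_2d_pt M x y).
{ intros x y; unfold M; apply continuity_2d_pt_mult.
  - apply (continuity_2d_pt_comp N); [|auto..].
    unfold N; apply continuity_2d_pt_plus; [apply HW1|apply HW2].
  - apply continuity_2d_pt_minus.
    + apply (continuity_2d_pt_mult b (fun u v => b u v * 1)); [auto|].
      apply continuity_2d_pt_mult; [auto|apply continuity_2d_pt_const].
    + apply continuity_2d_pt_mult; auto. }
assert (cont_D : forall x y, continuity_2d_pt D x y).
{ intros x y; unfold D; apply continuity_2d_pt_minus.
  - apply continuity_2d_pt_mult; auto.
  - apply (continuity_2d_pt_mult B (fun u v => B u v * 1)); [auto|].
    apply continuity_2d_pt_mult; [auto|apply continuity_2d_pt_const]. }
destruct (Rle_or_lt (M x0 y0) 0) as [h|HM0]; [exact h|exfalso].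
destruct (bounded_on_box D 2 ltac:(lra) cont_D) as [DB [HDB D_le]].
destruct (cont_M x0 y0 (mkposreal (M x0 y0 / 2) ltac:(lra))) as [e1 He1]; simpl in He1.
destruct (C1_continuity _ _ _ x0 y0 Hr (mkposreal 1 Rlt_0_1)) as [e2 He2]; simpl in He2.
set (s := Rmin (e1 / 2) (e2 / 2)).
assert (Hs : 0 < s /\ s <= e1 / 2 /\ s <= e2 / 2).
{ generalize (cond_pos e1) (cond_pos e2); intros.
  repeat split; [apply Rmin_pos; lra|apply Rmin_l|apply Rmin_r]. }
assert (near : forall x y, x0 - s <= x <= x0 + s -> y0 - s <= y <= y0 + s ->
  M x0 y0 / 2 <= M x y /\ r x y <= r x0 y0 + 1).
{ intros x y Hx Hy; generalize (cond_pos e1) (cond_pos e2); intros.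
  assert (dx1 : Rabs (x - x0) < e1) by (apply Rabs_lt_between; lra).
  assert (dy1 : Rabs (y - y0) < e1) by (apply Rabs_lt_between; lra).
  assert (dx2 : Rabs (x - x0) < e2) by (apply Rabs_lt_between; lra).
  assert (dy2 : Rabs (y - y0) < e2) by (apply Rabs_lt_between; lra).
  assert (I1 := He1 x y dx1 dy1); assert (I2 := He2 x y dx2 dy2).
  apply Rabs_lt_between in I1; apply Rabs_lt_between in I2; lra. }
(* The box of half-width [l] contains both the square around (x0, y0) and the box of half-width 2
   outside which the error is absent. *)
set (l := 2 + Rabs x0 + Rabs y0 + s).
(* On the square [M] keeps half its value, the cube of the cut-off is at least 1 / 8, and Young's
   inequality leaves half of the product. *)
set (m := M x0 y0 / 32).
assert (Hm : 0 < m) by (unfold m; lra).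
(* The first summand keeps the cut-off above 1 / 2 on the square, where r <= r x0 y0 + 1; the second
   makes the total error smaller than the gain. *)
set (ell := 2 * ln (2 + r x0 y0) + 18 * K * DB * l ^ 2 / (m * s ^ 2) + 1).
assert (Hl : 2 <= l) by (unfold l; generalize (Rabs_pos x0) (Rabs_pos y0); lra).
assert (ms : 0 < m * s ^ 2) by (apply Rmult_lt_0_compat; [lra|apply pow_lt; lra]).
assert (Hln : 0 < ln (2 + r x0 y0)).
{ rewrite <- ln_1; apply ln_increasing; generalize (r_pos x0 y0); lra. }
assert (Hbig : 0 < 18 * K * DB * l ^ 2 / (m * s ^ 2)).
{ apply Rdiv_lt_0_compat; [|exact ms].
  apply Rmult_lt_0_compat; [|apply pow_lt; lra].
  repeat (apply Rmult_lt_0_compat; [|assumption]); lra. }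
assert (Hell : 0 < ell) by (unfold ell; lra).
set (k := 9 * K / (4 * ell)).
(* The sign is reversed because det H <= 0, so that the main term of the divergence becomes Q^3
   [M]. *)
assert (Hcut := C1_scal (- 1) _ _ _ (C1_comp1 _ _ _ _ _
    (fun x y => is_derive_log_cut3 ell _ Hell (r_pos x y))
    (fun x y => continuous_log_cut3' ell _ Hell (r_pos x y)) Hr)).
assert (Hcor := C1_comp1 _ _ _ _ _
    (fun x y => is_derive_corrector k ell _ Hell (r_pos x y))
    (fun x y => continuous_corrector' k ell _ Hell (r_pos x y)) Hr).
destruct (C1_cofactor_field _ _ _ _ _ _ _ _ _ _ _ _ _ _ _ _ Hcut Ha Hb Hd HX HY)
  as [V1 [V2 [W1 [W2 [HV [HW E1]]]]]].
destruct (C1_cofactor_field _ _ _ _ _ _ _ _ _ _ _ _ _ _ _ _ Hcor HA HB HC HF HG)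
  as [V1' [V2' [W1' [W2' [HV' [HW' E2]]]]]].
assert (HT := C1_plus _ _ _ _ _ _ HV HV'); assert (HS := C1_plus _ _ _ _ _ _ HW HW').
assert (total : forall x y, let Q := log_cut ell (r x y) in
  Q ^ 3 * M x y / 2 - 18 * K / ell * D x y <= V1 x y + V1' x y + (W2 x y + W2' x y) /\
  (2 <= r x y -> Q ^ 3 * M x y / 2 <= V1 x y + V1' x y + (W2 x y + W2' x y))).
{ intros x y Q.
  assert (HQ : 0 <= Q <= 1)
    by (split; [apply pos_ge_0|now apply log_cut_le_1]).
  assert (I := cutoff_inequality K ell Q (r x y) (M x y) (D x y) _ _ (F x y) (G x y)
    HK Hell HQ (M_ge_0 x y) (D_pos x y) (Er x y) (keyx x y)).
  (* Since grad r = J Lambda and J is symmetric, the gradient of the cut-off is paired with J cof H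
     X, while that of the corrector produces det J |Lambda|^2 = 2 r det J. *)
  assert (ET : V1 x y + V1' x y + (W2 x y + W2' x y) =
    Q ^ 3 * M x y + 3 * Q ^ 2 / (ell * (1 + r x y)) *
      (F x y * (A x y * Z1 x y + B x y * Z2 x y) + G x y * (B x y * Z1 x y + C x y * Z2 x y))
    + 2 * D x y * (- k * (Q ^ 2 * kappa (r x y)) + r x y *
      (- k * (- 2 * Q / (ell * (1 + r x y)) * kappa (r x y) + Q ^ 2 * kappa' (r x y))))).
  { transitivity ((V1 x y + W2 x y) + (V1' x y + W2' x y)); [ring|].
    rewrite E1, E2; unfold M, N, Z1, Z2, D; cbv beta; fold Q.
    set (h' := - k * (- 2 * Q / (ell * (1 + r x y)) * kappa (r x y)
      + Q ^ 2 * kappa' (r x y))).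
    set (h := kappa (r x y)); set (z' := ell * (1 + r x y)).
    assert (z0 : 0 < z')
      by (apply Rmult_lt_0_compat; generalize (r_pos x y); lra).
    rewrite (Er x y); unfold Rdiv.
    set (i := / rad (p x y) (q x y)); field; lra. }
  rewrite ET; exact I. }
assert (LL : 0 <= exp ell) by (apply Rlt_le, exp_pos).
assert (Supp : forall x y, l + exp ell <= Rabs x \/ l + exp ell <= Rabs y ->
  log_cut ell (r x y) = 0).
{ intros x y Hxy; apply log_cut_eq_0; [exact Hell|].
  assert (I := r_ge x y); rewrite <- (pow2_abs x), <- (pow2_abs y) in I.
  generalize (pow2_ge_0 (Rabs x)) (pow2_ge_0 (Rabs y)); intros.
  destruct Hxy; nra. }
(* Thus the negative part of the divergence lives in a fixed box, where [D] is at most [DB] whatever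
   [ell] is. *)
assert (far : forall x y, 2 < Rabs x \/ 2 < Rabs y -> 2 <= r x y).
{ intros x y Hxy; assert (I := r_ge x y); rewrite <- (pow2_abs x), <- (pow2_abs y) in I.
  generalize (pow2_ge_0 (Rabs x)) (pow2_ge_0 (Rabs y)); intros.
  destruct Hxy; nra. }
assert (gain_ge_0 : forall x y, 0 <= log_cut ell (r x y) ^ 3 * M x y / 2).
{ intros x y; assert (0 <= log_cut ell (r x y) ^ 3 * M x y); [|lra].
  apply Rmult_le_pos; [apply pow_le, pos_ge_0|apply M_ge_0]. }
set (e := 18 * K / ell * DB).
assert (K_ell : 0 < 18 * K / ell) by (apply Rdiv_lt_0_compat; lra).
assert (lower : forall x y, log_cut ell (r x y) ^ 3 * M x y / 2 - e <=
  V1 x y + V1' x y + (W2 x y + W2' x y)).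
{ intros x y; destruct (total x y) as [T1 T2]; unfold e.
  assert (He : 0 <= 18 * K / ell * DB) by (apply Rmult_le_pos; lra).
  destruct (Rlt_or_le 2 (Rabs x)) as [hx|hx]; [generalize (T2 (far x y (or_introl hx))); lra|].
  destruct (Rlt_or_le 2 (Rabs y)) as [hy|hy]; [generalize (T2 (far x y (or_intror hy))); lra|].
  generalize (Rmult_le_compat_l _ _ _ (Rlt_le _ _ K_ell) (D_le x y hx hy)); lra. }
assert (He : 0 <= e) by (apply Rmult_le_pos; lra).
assert (bal := divergence_balance _ _ _ _ _ _ (l + exp ell) l x0 y0 s m e HT HS).
assert (final : m * (2 * s) * (2 * s) <= e * (2 * l) * (2 * l)).
{ apply bal; try lra; clear bal.
  - intros x y Hxy; rewrite (Supp x y Hxy); split; ring.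
  - unfold l; generalize (Rabs_pos y0); lra.
  - unfold l; generalize (Rabs_pos x0); lra.
  - intros x y Hxy; apply Rle_trans with (1 := gain_ge_0 x y), total, far.
    destruct Hxy; [left|right]; lra.
  - intros x y; generalize (gain_ge_0 x y) (lower x y); lra.
  - intros x y Hx Hy; apply Rle_trans with (2 := lower x y).
    destruct (near x y Hx Hy) as [n1 n2].
    assert (half : / 2 <= log_cut ell (r x y)).
    { apply log_cut_ge_half; [exact Hell|].
      assert (ln (1 + r x y) <= ln (2 + r x0 y0)).
      { destruct (Rle_lt_or_eq_dec (1 + r x y) (2 + r x0 y0) ltac:(lra)) as [h| ->];
          [|lra].
        apply Rlt_le, ln_increasing; [generalize (r_pos x y)|]; lra. }
      unfold ell; lra. }
    assert (cube : / 8 <= log_cut ell (r x y) ^ 3).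
    { replace (/ 8) with ((/ 2) ^ 3) by field; apply pow_incr; lra. }
    assert (/ 8 * (M x0 y0 / 2) <= log_cut ell (r x y) ^ 3 * M x y).
    { apply Rmult_le_compat; lra. }
    unfold m; lra. }
assert (small : e * l ^ 2 < m * s ^ 2).
{ unfold e; apply Rmult_lt_reg_r with ell; [exact Hell|].
  replace (18 * K / ell * DB * l ^ 2 * ell) with
    (18 * K * DB * l ^ 2 / (m * s ^ 2) * (m * s ^ 2)) by (field; lra).
  rewrite (Rmult_comm (m * s ^ 2)); apply Rmult_lt_compat_r; [exact ms|].
  unfold ell; lra. }
lra.
Qed.

(** * Entire solutions *)

Lemma class_C_plane_S (n : nat) (u : R -> R -> R) :
  class_C_plane (S n) u ->
  C1 u (partial_x u) (partial_y u) /\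
  class_C_plane n (partial_x u) /\ class_C_plane n (partial_y u).
Proof.
intros H; split; [|split; intros x y; apply H].
apply C1_of_partials; intros x y; destruct (H x y) as [_ [Hx [Hy [Hpx Hpy]]]].
- now apply Derive_correct.
- now apply Derive_correct.
- destruct n; apply Hpx.
- destruct n; apply Hpy.
Qed.

Lemma partial_xy (n : nat) (u : R -> R -> R) (x y : R) :
  class_C_plane (S (S n)) u ->
  partial_x (partial_y u) x y = partial_y (partial_x u) x y.
Proof.
intros H; destruct (class_C_plane_S _ _ H) as [Cu [Hx Hy]].
destruct (class_C_plane_S _ _ Hx) as [Cx _].
destruct (class_C_plane_S _ _ Hy) as [Cy _].
apply Schwarz; [|apply Cy|apply Cx].
apply locally_2d_forall; intros v w; repeat split.
- eexists; exact (C1_is_derive_x _ _ _ v w Cu).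
- eexists; exact (C1_is_derive_y _ _ _ v w Cu).
- eexists; exact (C1_is_derive_x _ _ _ v w Cy).
- eexists; exact (C1_is_derive_y _ _ _ v w Cx).
Qed.

(** A nonzero partial stays nonzero in a neighbourhood; there [f] vanishes identically, and so does
    its partial. Applied to the gradient components, this settles critical points. *)
Lemma partial_eq_0 (f f1 f2 : R -> R -> R) :
  C1 f f1 f2 ->
  ((forall x y, f1 x y <> 0 -> f x y = 0) -> forall x y, f1 x y = 0) /\
  ((forall x y, f2 x y <> 0 -> f x y = 0) -> forall x y, f2 x y = 0).
Proof.
intros Hf; split; intros H x y.
- destruct (Req_dec (f1 x y) 0) as [h|h]; [exact h|].
  assert (loc := continuity_2d_pt_neq_0 f1 x y (proj1 (proj2 (Hf x y))) h).
  rewrite <- (is_derive_unique _ _ _ (C1_is_derive_x f f1 f2 x y Hf)).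
  rewrite (Derive_ext_loc _ (fun _ => 0)); [apply Derive_const|].
  generalize (locally_2d_1d_const_y _ x y loc); apply filter_imp; auto.
- destruct (Req_dec (f2 x y) 0) as [h|h]; [exact h|].
  assert (loc := continuity_2d_pt_neq_0 f2 x y (proj2 (proj2 (Hf x y))) h).
  rewrite <- (is_derive_unique _ _ _ (C1_is_derive_y f f1 f2 x y Hf)).
  rewrite (Derive_ext_loc _ (fun _ => 0)); [apply Derive_const|].
  generalize (locally_2d_1d_const_x _ x y loc); apply filter_imp; auto.
Qed.

Lemma constant_slope (f : R -> R) (k x : R) :
  (forall t, is_derive f t k) -> f x = f 0 + k * x.
Proof.
intros H; destruct (MVT_gen f 0 x (fun _ => k)) as [t [_ E]].
- intros; apply H.
- intros t _; apply continuity_pt_filterlim.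
  apply (@ex_derive_continuous R_AbsRing R_NormedModule); exists k; apply H.
- rewrite Rminus_0_r in E; lra.
Qed.

Lemma affine_of_hessian_eq_0 (u p q a b b' d : R -> R -> R) :
  C1 u p q -> C1 p a b -> C1 q b' d ->
  (forall x y, a x y = 0) -> (forall x y, b x y = 0) ->
  (forall x y, b' x y = 0) -> (forall x y, d x y = 0) -> affine u.
Proof.
intros Hu Hp Hq Ha Hb Hb' Hd.
assert (cst : forall f f1 f2, C1 f f1 f2 -> (forall x y, f1 x y = 0) ->
  (forall x y, f2 x y = 0) -> forall x y, f x y = f 0 0).
{ intros f f1 f2 Hf H1 H2 x y.
  rewrite (constant_slope (fun t => f x t) 0 y), (constant_slope (fun s => f s 0) 0 x).
  - ring.
  - intros s; assert (K := C1_is_derive_x f f1 f2 s 0 Hf); now rewrite H1 in K.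
  - intros t; assert (K := C1_is_derive_y f f1 f2 x t Hf); now rewrite H2 in K. }
exists (p 0 0), (q 0 0), (u 0 0); intros x y.
rewrite (constant_slope (fun t => u x t) (q 0 0) y),
  (constant_slope (fun s => u s 0) (p 0 0) x).
- ring.
- intros s; rewrite <- (cst _ _ _ Hp Ha Hb s 0).
  apply (C1_is_derive_x u p q); exact Hu.
- intros t; rewrite <- (cst _ _ _ Hq Hb' Hd x t).
  apply (C1_is_derive_y u p q); exact Hu.
Qed.

Lemma flux_ratio (g : R -> R) (p q : R) :
  flux g (p, q) = (ratio g^[1] (rad p q) * p, ratio g^[1] (rad p q) * q).
Proof.
unfold flux; simpl fst; simpl snd.
change (euclid_norm (p, q)) with (rad p q).
destruct (Req_EM_T (rad p q) 0) as [h|h]; [|reflexivity].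
destruct (rad_eq_0 p q h) as [-> ->]; now rewrite !Rmult_0_r.
Qed.

(** Away from critical points the flux is a smooth function of the gradient there, so the divergence
    expands by the chain rule; multiplying it by t^2 gives the elliptic form. *)
Lemma elliptic_of_div (g : R -> R) (c0 c L : R) (p q a b b' d : R -> R -> R) (x y : R) :
  energy_density g g^[1] g^[2] c0 c L -> C1 p a b -> C1 q b' d -> b' x y = b x y ->
  div (fun s t => flux g (p s t, q s t)) x y = 0 -> rad (p x y) (q x y) <> 0 ->
  elliptic g^[1] g^[2] (p x y) (q x y) (a x y) (b x y) (d x y).
Proof.
intros E Hp Hq Hb Hdiv Hr.
set (t := rad (p x y) (q x y)) in *.
assert (Ht : 0 < t) by (generalize (rad_pos (p x y) (q x y)); unfold t in *; lra).
assert (D := is_derive_ratio _ _ _ _ _ _ _ E Ht).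
assert (Et := rad_sqr (p x y) (q x y)); fold t in Et.
assert (mono : C1 (fun p _ => p) (fun _ _ => 1) (fun _ _ => 0) /\
               C1 (fun _ q => q) (fun _ _ => 0) (fun _ _ => 1)).
{ split; apply C1_of_partials; intros; try apply continuity_2d_pt_const;
    auto_derive; auto. }
assert (D1 := radial_mult_differentiable _ _ _ _ _ _ _ (proj1 mono) Hr D).
assert (D2 := radial_mult_differentiable _ _ _ _ _ _ _ (proj2 mono) Hr D).
cbv beta in D1, D2; fold t in D1, D2.
assert (X := derivable_pt_lim_comp_2d _ (fun s => p s y) (fun s => q s y) x _ _ _ _ D1
  (proj1 (is_derive_Reals _ _ _) (C1_is_derive_x _ _ _ x y Hp))
  (proj1 (is_derive_Reals _ _ _) (C1_is_derive_x _ _ _ x y Hq))).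
assert (Y := derivable_pt_lim_comp_2d _ (fun s => p x s) (fun s => q x s) y _ _ _ _ D2
  (proj1 (is_derive_Reals _ _ _) (C1_is_derive_y _ _ _ x y Hp))
  (proj1 (is_derive_Reals _ _ _) (C1_is_derive_y _ _ _ x y Hq))).
apply is_derive_Reals in X; apply is_derive_Reals in Y.
unfold div, partial_x, partial_y in Hdiv.
rewrite (Derive_ext _ (fun s => ratio g^[1] (rad (p s y) (q s y)) * p s y)) in Hdiv
  by (intros; now rewrite flux_ratio).
rewrite (Derive_ext (fun s => snd _) (fun s => ratio g^[1] (rad (p x s) (q x s)) * q x s))
  in Hdiv by (intros; now rewrite flux_ratio).
rewrite (is_derive_unique _ _ _ X), (is_derive_unique _ _ _ Y), Hb in Hdiv.
unfold elliptic; fold t; rewrite <- (Rmult_0_r (t ^ 2)), <- Hdiv.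
unfold ratio', ratio.
transitivity ((g^[2] t - g^[1] t / t) * (p x y ^ 2 * a x y + 2 * p x y * q x y * b x y +
  q x y ^ 2 * d x y) + g^[1] t / t * (p x y ^ 2 + q x y ^ 2) * (a x y + d x y)); [ring|].
rewrite <- Et; field; exact Hr.
Qed.

Theorem theorem1p1 (g : R -> R)
  (g_C3 : class_C_within nonneg_half_line 3 g)
  (g3_0 : g^[3] 0 = 0)
  (g1_0 : g^[1] 0 = 0)
  (g2_pos : forall t : R, 0 <= t -> 0 < g^[2] t)
  (g_linear_growth : exists m M : R, 0 < m /\ 0 < M /\
     forall t : R, 0 <= t -> m * (t - 1) <= g t <= M * (t + 1))
  (g2_decay : exists mu c : R, 1 < mu /\ 0 < c /\
     forall t : R, 0 <= t -> g^[2] t <= c * Rpower (1 + t) (- mu))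
  (g2_integral : ex_RInt_gen (fun s : R => s * g^[2] s)
                   (at_point 0) (Rbar_locally p_infty))
  (u : R -> R -> R)
  (u_C3 : class_C_plane 3 u)
  (u_sol : forall x y : R, div (fun s t : R => flux g (grad u s t)) x y = 0) :
  affine u.
Proof.
destruct (energy_density_intro g g_C3 g1_0 g2_pos g2_decay g2_integral)
  as [c0 [c [L E]]].
destruct (class_C_plane_S _ _ u_C3) as [Hu [Cp Cq]].
set (p := partial_x u) in *; set (q := partial_y u) in *.
destruct (class_C_plane_S _ _ Cp) as [Hp [Ca Cb]].
destruct (class_C_plane_S _ _ Cq) as [Hq [_ Cd]].
set (a := partial_x p) in *; set (b := partial_y p) in *; set (d := partial_y q) in *.
(* The cofactor identity needs shared partials, so mixed derivatives of orders two and three are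
   identified here and in [Hb] and [Hd]. *)
assert (sym : forall x y, partial_x q x y = b x y)
  by (intros; apply (partial_xy 1 u); exact u_C3).
assert (Hq' : C1 q b d) by (apply C1_ext with (4 := Hq); auto).
assert (Ha := proj1 (class_C_plane_S _ _ Ca)).
assert (Hb : C1 b (partial_y a) (partial_y b)).
{ apply C1_ext with (4 := proj1 (class_C_plane_S _ _ Cb)); auto.
  intros; apply (partial_xy 0 p); exact Cp. }
assert (Hd : C1 d (partial_y b) (partial_y d)).
{ apply C1_ext with (4 := proj1 (class_C_plane_S _ _ Cd)); auto.
  intros x y; unfold d; rewrite (partial_xy 0 q x y Cq).
  apply Derive_ext; intros; apply sym. }
assert (Heq : forall x y, rad (p x y) (q x y) <> 0 ->
  elliptic g^[1] g^[2] (p x y) (q x y) (a x y) (b x y) (d x y)).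
{ intros x y; apply (elliptic_of_div g c0 c L p q a b b d); auto; apply u_sol. }
assert (flat := hessian_eq_0 _ _ _ _ _ _ _ _ _ _ _ _ _ _ _ E Hp Hq' Ha Hb Hd Heq).
(* The contrapositive of [flat], in the form that [partial_eq_0] takes. *)
assert (zero : forall x y, a x y <> 0 \/ b x y <> 0 \/ d x y <> 0 ->
  p x y = 0 /\ q x y = 0).
{ intros x y H; apply rad_eq_0.
  destruct (Req_dec (rad (p x y) (q x y)) 0) as [h|h]; [exact h|].
  destruct (flat x y h) as [h1 [h2 h3]]; tauto. }
assert (b0 : forall x y, b x y = 0)
  by (apply (partial_eq_0 _ _ _ Hp); intros x y H; apply (zero x y); auto).
apply (affine_of_hessian_eq_0 u p q a b b d Hu Hp Hq'); auto.
- apply (partial_eq_0 _ _ _ Hp); intros x y H; apply (zero x y); auto.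
- apply (partial_eq_0 _ _ _ Hq'); intros x y H; apply (zero x y); auto.
Qed.
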